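(* Consider standard binary branching Brownian motion with natural filtration $(\mathcal F_t)_{t\ge0}$ and rightmost position $M_t$ at time $t$. Let $0\le R\le s\le t$ and let $x,y\in\mathbb R$. Let $u_s^*$ (resp. $u_t^*$) denote the rightmost particle at time $s$ (resp. $t$). Then, almost surely, $$\mathbb P\left(M_s\ge x,\ M_t\ge y,\ Q(u_s^*,u_t^* )\le R\,\middle|\,\mathcal F_R\right)\le\mathbb P\left(M_s\ge x\,\middle|\,\mathcal F_R\right)\,\mathbb P\left(M_t\ge y\,\middle|\,\mathcal F_R\right).$$
   Context: Standard binary branching Brownian motion (BBM): one particle starts at $0$ at time $0$ and performs standard Brownian motion on $\mathbb{R}$; each particle lives an independent exponential time of mean $1$, then splits into two offspring at its current position, which evolve independently with the same dynamics. $\mathcal N_t$ is the set of particles alive at time $t$; for $u\in\mathcal N_t$ and $s\le t$, $X_u(s)$ is the position at time $s$ of $u$ or of its ancestor alive at time $s$. $X(t)=(X_u(t),u\in\mathcal N_t)$, $\mathcal F_t=\sigma\{X(s),s\le t\}$, and $M_t=\max_{u\in\mathcal N_t}X_u(t)$; the rightmost particle at a fixed time is almost surely unique. For $(u,v)\in\mathcal N_s\times\mathcal N_t$, the splitting time is $Q(u,v):=\sup\{\gamma\ge0: X_u(\phi)=X_v(\phi)\text{ for all }\phi\le\gamma\}$, where $\gamma$ ranges over times at which both paths are defined, i.e. $\gamma\le\min(s,t)$. *)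

(* Defs.v *)
From HB Require Import structures.
From mathcomp Require Import all_boot all_order all_algebra.
From mathcomp Require Import all_classical all_reals all_analysis.

Set Implicit Arguments.
Unset Strict Implicit.
Unset Printing Implicit Defensive.

Import Order.TTheory GRing.Theory Num.Theory.
Import numFieldNormedType.Exports.

Local Open Scope classical_set_scope.
Local Open Scope ring_scope.

Section Probability.
Context {d : measure_display} {T : measurableType d} {R : realType}.
Variable P : probability T R.

(* The sigma-algebra generated by the real random variables [X i], [i] in [J]. *)
Definition sigma_family (I : Type) (J : set I) (X : I -> T -> R) :
    set (set T) :=
  <<s \bigcup_(i in J) preimage_set_system setT (X i) measurable >>.

Definition sigma_var (X : T -> R) : set (set T) :=
  sigma_family setT (fun _ : unit => X).

Definition mutually_independent (I : eqType) (G : I -> set (set T)) : Prop :=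
  forall (J : seq I) (E : I -> set T), uniq J ->
    (forall i, i \in J -> G i (E i)) ->
    P (\bigcap_(i in [set` J]) E i) = (\prod_(i <- J) P (E i))%E.

(* [f] is a version of the conditional probability P(A | G). *)
Definition is_cond_prob (G : set (set T)) (A : set T) (f : T -> R) : Prop :=
  [/\ forall Y : set R, measurable Y -> G (f @^-1` Y),
      P.-integrable setT (EFin \o f) &
      forall C : set T, G C -> (\int[P]_(w in C) (f w)%:E = P (A `&` C))%E].

(* The standard Brownian motion is indexed by the nonnegative reals: the values
   at negative times are unconstrained and never used.  Independence of the
   increments over finitely many intervals is obtained from sequences [t] that
   are eventually constant. *)
Definition is_brownian_motion (W : R -> {RV P >-> R}) : Prop :=
  [/\ forall w, W 0 w = 0,
      forall w, {within [set t : R | 0 <= t], continuous (fun t => W t w)},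
      forall (s t : R) (A : set R), 0 <= s -> s < t -> measurable A ->
        P [set w | A (W t w - W s w)] = normal_prob 0 (Num.sqrt (t - s)) A &
      forall t : nat -> R, 0 <= t 0%N -> {homo t : i j / (i <= j)%N >-> i <= j} ->
        mutually_independent
          (fun i => sigma_var (fun w => W (t i.+1) w - W (t i) w))].

End Probability.

(* Ulam-Harris labels: the root is [::] and the offspring of [u] are
   [rcons u false] and [rcons u true]; the ancestors of [u], itself included,
   are the words [take i u] with [i <= size u]. *)
Definition particle := seq bool.

Section BranchingBrownianMotion.
Context {d : measure_display} {T : measurableType d} {R : realType}.
Variable P : probability T R.
(* [tau u] is the lifetime of [u]; [B u a] is the displacement of [u], from its
   birthplace, at age [a]. *)
Variables (tau : particle -> {RV P >-> R}) (B : particle -> R -> {RV P >-> R}).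

Definition is_BBM : Prop :=
  [/\ forall u (A : set R), measurable A ->
        P (tau u @^-1` A) = exponential_prob 1 A,
      forall u, is_brownian_motion (B u) &
      mutually_independent P (fun k : particle + particle =>
        match k with
        | inl u => sigma_var (tau u)
        | inr u => sigma_family [set a : R | 0 <= a] (B u)
        end)].

Definition birth (u : particle) (w : T) : R :=
  \sum_(i < size u) tau (take i u) w.

Definition death (u : particle) (w : T) : R := birth u w + tau u w.

(* The set N_t. *)
Definition alive (t : R) (w : T) : set particle :=
  [set u | birth u w <= t < death u w].

(* The time that [u] has lived during [0, s]: 0 before its birth, its age while
   it is alive, its whole lifetime afterwards. *)
Definition lived (u : particle) (s : R) (w : T) : R :=
  Num.max 0 (Num.min (s - birth u w) (tau u w)).

(* X_u(s): the displacements accumulated up to time [s] along the ancestral line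
   of [u].  For [u] in N_t and [s <= t], ancestors dead by time [s] contribute
   their whole displacement, the one alive at time [s] its displacement so far,
   and those born after [s] contribute B(0) = 0; hence this is the position at
   time [s] of the ancestor of [u] alive at that time. *)
Definition position (u : particle) (s : R) (w : T) : R :=
  \sum_(i < (size u).+1) B (take i u) (lived (take i u) s w) w.

(* Generated by the labelled configurations X(s) = (X_u(s), u in N_s), [s <= t];
   taking [A = setT] gives the events {u in N_s}. *)
Definition filtration (t : R) : set (set T) :=
  <<s [set E | exists s u (A : set R), [/\ 0 <= s <= t, measurable A &
         E = [set w | alive s w u /\ A (position u s w)]]] >>.

(* M_t.  N_t is almost surely finite and nonempty, and the supremum is then a
   maximum. *)
Definition max_position (t : R) (w : T) : \bar R :=
  ereal_sup [set (position u t w)%:E | u in alive t w].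

(* Q(u, v) for (u, v) in N_s x N_t. *)
Definition splitting_time (s t : R) (u v : particle) (w : T) : R :=
  sup [set g | 0 <= g <= Num.min s t /\
               forall a, 0 <= a <= g -> position u a w = position v a w].

Definition is_rightmost (t : R) (w : T) (u : particle) : Prop :=
  alive t w u /\ forall v, alive t w v -> position v t w <= position u t w.

(* The rightmost particle is only almost surely defined and unique, so it is a
   random label determined up to a null set. *)
Definition rightmost_particle (t : R) (ustar : T -> particle) : Prop :=
  (forall u, measurable (ustar @^-1` [set u])) /\
  {ae P, forall w, is_rightmost t w (ustar w)}.

End BranchingBrownianMotion.

(* Main.v *)
Require Import Defs.
From HB Require Import structures.
From mathcomp Require Import all_boot all_order all_algebra.
From mathcomp Require Import all_classical all_reals all_analysis.
From mathcomp Require Import measurable_realfun ring lra.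

Set Implicit Arguments.
Unset Strict Implicit.
Unset Printing Implicit Defensive.

Import Order.TTheory GRing.Theory Num.Theory.
Import numFieldNormedType.Exports.

Local Open Scope classical_set_scope.
Local Open Scope ring_scope.

(* Given the past up to time r, distinct particles alive at time r have
   independent progenies, and when Q <= r the rightmost particles at times s and t
   descend from distinct particles alive at time r.  The event on the left is thus
   contained in "some v reaches x at time s and some w <> v reaches y at time t",
   and for pairs of events (A_v, B_v) independent over v,
     P(exists v <> w, A_v and B_w) <= P(exists v, A_v) P(exists w, B_w).
   With a, b, n, c the probabilities of not A, not B, neither and both, this reads
   prod n <= prod a prod b + sum_v c_v prod_(w <> v) n_w.
   The conditional law of the progeny of v depends on the past through the age and
   the position of v at time r.  Only finitely many labels are used at a time,
   before a monotone limit is taken. *)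

(** Two obstacles shape the proof. The motion of [v] has to be cut at its age at time [r], which is
    random, while Brownian increments are known to be independent only at fixed times. This age
    depends only on the lifetimes of the strict ancestors of [v], so the sample point is doubled:
    the clocks outside the progeny of [v] are read off one copy and those inside off another,
    independent one. With the first copy frozen the age is a constant, and a second doubling
    separates the motion before that age from what follows. The lifetime of [v] counts as future,
    and survival up to the age is conditioned upon by a division. The second obstacle is that the
    set of particles alive at time [r] is random, whereas products run over fixed lists of labels. A
    label not alive at time [r] is given the outcome (false, false), which contributes a factor 1 to
    the products of miss probabilities; labels of which one is an ancestor of the other share
    clocks, but they are never alive together. Conditional statements are proved in integrated form,
    over an arbitrary event of the past. *)

Definition indep {d : measure_display} {T : measurableType d} {R : realType}
    (P : probability T R) (G0 G1 : set (set T)) : Prop :=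
  forall A B, G0 A -> G1 B -> (P (A `&` B) = P A * P B)%E.

(** * Independence of generated sigma-algebras *)

Section Independence.
Context {d : measure_display} {T : measurableType d} {R : realType}.
Variable P : probability T R.
Local Open Scope ereal_scope.

Lemma indepC (G0 G1 : set (set T)) : indep P G0 G1 -> indep P G1 G0.
Proof. by move=> h A B GA GB; rewrite setIC muleC h. Qed.

Lemma indepS (G0 G1 H0 H1 : set (set T)) :
  G0 `<=` H0 -> G1 `<=` H1 -> indep P H0 H1 -> indep P G0 G1.
Proof. by move=> s0 s1 h A B /s0 HA /s1; exact: h. Qed.

Lemma g_sigma_measurable (C : set (set T)) :
  C `<=` measurable -> <<s C >> `<=` measurable.
Proof. by move=> mC; apply: smallest_sub => //; exact: sigma_algebra_measurable. Qed.

(** For a fixed [B] the sets independent of [B] form a Dynkin system, and the pi-system [C0]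
    generates the same Dynkin system as sigma-algebra. One side is extended at a time; symmetry then
    gives both. *)
Lemma indep_g_sigmal (C0 G1 : set (set T)) : setI_closed C0 ->
  C0 `<=` measurable -> G1 `<=` measurable ->
  indep P C0 G1 -> indep P <<s C0 >> G1.
Proof.
move=> CI mC mG h A B CA GB; have mB := mG _ GB.
pose D := [set A | measurable A /\ P (A `&` B) = P A * P B].
suff : <<s C0 >> `<=` D by move=> /(_ _ CA)[].
rewrite -setI_closed_g_dynkin_g_sigma_algebra//.
apply: smallest_sub; last by move=> E CE; split; [exact: mC|exact: h].
have fP E : measurable E -> P E \is a fin_num.
  by move=> mE; exact: fin_num_measure.
split.
- by split => //; rewrite setTI probability_setT mul1e.
- move=> E [mE hE]; split; first exact: measurableC.
  have -> : ~` E `&` B = B `\` E by rewrite setIC setDE.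
  rewrite measureD//; last by rewrite ltey_eq fP.
  rewrite [X in _ - P X]setIC hE probability_setC// muleBl ?mul1e ?fP//.
- move=> F tF FD; have mF n : measurable (F n) by case: (FD n).
  have mU : measurable (\bigcup_k F k) by exact: bigcupT_measurable.
  split => //.
  rewrite setI_bigcupl measure_bigcup//; last 2 first.
    by move=> n _; exact: measurableI.
    by apply/trivIsetP => i j _ _ ij; rewrite setIACA; move/trivIsetP : tF => ->//;
      rewrite set0I.
  rewrite measure_bigcup//.
  rewrite -(fineK (fP _ mB)) muleC -nneseriesZl//.
  by apply: eq_eseriesr => n _; rewrite muleC fineK ?fP//; case: (FD n).
Qed.

Lemma indep_g_sigma (C0 C1 : set (set T)) :
  setI_closed C0 -> setI_closed C1 ->
  C0 `<=` measurable -> C1 `<=` measurable ->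
  indep P C0 C1 -> indep P <<s C0 >> <<s C1 >>.
Proof.
move=> I0 I1 m0 m1 h; apply: indep_g_sigmal => //; first exact: g_sigma_measurable.
by apply/indepC/indep_g_sigmal => //; exact: indepC.
Qed.

End Independence.

Section FiniteIntersections.
Context {T : Type} {I : eqType}.

(** A pi-system generating the join of the [G i], in the form on which [mutually_independent]
    evaluates probabilities. *)
Definition finI_from (J : set I) (G : I -> set (set T)) : set (set T) :=
  [set E | exists (s : seq I) (F : I -> set T),
    (forall i, i \in s -> J i /\ G i (F i)) /\ E = \bigcap_(i in [set` s]) F i].

Lemma finI_from_setI (J : set I) (G : I -> set (set T)) :
  (forall i, J i -> setI_closed (G i)) -> (forall i, J i -> G i setT) ->
  setI_closed (finI_from J G).
Proof.
move=> GI GT _ _ [s [F [hF ->]]] [s' [F' [hF' ->]]].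
(* An index occurring in only one of the lists contributes [setT] on the other side. *)
pose E i := (if i \in s then F i else setT) `&` (if i \in s' then F' i else setT).
exists (s ++ s'), E; split.
  move=> i; rewrite mem_cat => iss.
  have Ji : J i by case/orP: iss => [/hF[]|/hF'[]].
  split => //; apply: GI => //; case: ifPn => // h;
    by [case: (hF _ h)|case: (hF' _ h)|exact: GT].
apply/seteqP; split=> w.
  move=> [h h'] i _; split; case: ifPn => // is_; by [apply: h|apply: h'].
move=> h; split=> i /= is_.
  by have [] := h i; rewrite /= ?mem_cat ?is_//.
by have [] := h i; rewrite /= ?mem_cat ?is_ ?orbT//.
Qed.

Lemma finI_from_sub (J : set I) (G : I -> set (set T)) :
  \bigcup_(i in J) G i `<=` finI_from J G.
Proof.
move=> A [i Ji GA]; exists [:: i], (fun=> A); split.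
  by move=> j; rewrite inE => /eqP ->.
by apply/seteqP; split=> [w wA j _|w /(_ i)]//; apply; rewrite /= inE.
Qed.

End FiniteIntersections.

Section Grouping.
Context {d : measure_display} {T : measurableType d} {R : realType}.
Variable P : probability T R.
Local Open Scope ereal_scope.

(** On finite intersections, the product formula for the concatenation of two disjoint index lists
    splits into the formulas for each list. *)
Lemma indep_grouping (I : eqType) (G : I -> set (set T)) (J0 J1 : set I) :
  (forall i, sigma_algebra setT (G i)) -> (forall i, G i `<=` measurable) ->
  mutually_independent P G -> J0 `&` J1 = set0 ->
  indep P <<s \bigcup_(i in J0) G i >> <<s \bigcup_(i in J1) G i >>.
Proof.
move=> sG mG indG J01.
have GI i : setI_closed (G i).
  by move=> A B GA GB; rewrite -(sigma_algebra_id (sG i)) in GA GB *;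
    exact: (@measurableI _ (g_sigma_algebraType (G i))).
have GT i : G i setT.
  by rewrite -(sigma_algebra_id (sG i)); exact: (@measurableT _ (g_sigma_algebraType (G i))).
have mfin J : finI_from J G `<=` measurable.
  move=> _ [s [F [hF ->]]]; apply: fin_bigcap_measurable => [|i /= is_]; first exact: finite_seq.
  exact: (mG i _ (hF i is_).2).
have := @indep_g_sigma _ _ _ P (finI_from J0 G) (finI_from J1 G)
  (finI_from_setI (fun i _ => GI i) (fun i _ => GT i))
  (finI_from_setI (fun i _ => GI i) (fun i _ => GT i)) (mfin J0) (mfin J1).
move=> ind; apply: (indepS _ _ (ind _)); try
  by apply: sub_sigma_algebra2; exact: finI_from_sub.
move=> _ _ [s [F [hF ->]]] [s' [F' [hF' ->]]].
(* [mutually_independent] speaks of duplicate-free lists only. *)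
have undupE (r : seq I) : [set` r] = [set` undup r].
  by apply/seteqP; split=> i /=; rewrite mem_undup.
rewrite (undupE s) (undupE s').
have {}hF i : i \in undup s -> J0 i /\ G i (F i) by rewrite mem_undup; exact: hF.
have {}hF' i : i \in undup s' -> J1 i /\ G i (F' i) by rewrite mem_undup; exact: hF'.
have := undup_uniq s; have := undup_uniq s'.
move: (undup s) (undup s') hF hF' => {}s {}s' hF hF' us' us.
have dis i : i \in s -> i \in s' -> False.
  by move=> /hF[J0i _] /hF'[J1i _]; have : (J0 `&` J1) i by []; rewrite J01.
pose E i := if i \in s then F i else F' i.
have -> : \bigcap_(i in [set` s]) F i `&` \bigcap_(i in [set` s']) F' i =
    \bigcap_(i in [set` s ++ s']) E i.
  apply/seteqP; split=> w.
    move=> [h h'] i /=; rewrite mem_cat /E; case: ifPn => [is_ _|_ /=]; by [apply: h|apply: h'].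
  move=> h; split=> i /= is_.
    by have := h i; rewrite /= mem_cat /E is_; exact.
  have := h i; rewrite /= mem_cat /E is_ orbT; case: ifPn => [is2|_]; last exact.
  by case: (dis i).
have us0 : uniq (s ++ s').
  rewrite cat_uniq us us' andbT; apply/hasPn => i is_.
  by apply/negP => is2; exact: (dis i).
rewrite indG//; last first.
  move=> i; rewrite mem_cat /E; case: ifPn => [is_ _|_ /=]; first by case: (hF i).
  by move=> is_; case: (hF' i).
rewrite big_cat/= indG//; last by move=> i /hF[].
rewrite indG//; last by move=> i /hF'[].
congr (_ * _); apply: eq_big_seq => i is_; rewrite /E ?is_//.
by case: ifPn => // is2; case: (dis i).
Qed.

End Grouping.

(** * Tools: comparison sets, decoupling of sub-sigma-algebras, evaluation at random times *)

Section MeasurableSets.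
Context {d : measure_display} {M : measurableType d} {R : realType}.

Lemma measurable_set_bool (f : M -> bool) :
  measurable_fun setT f -> measurable [set m | f m].
Proof.
move=> mf; have := mf measurableT [set true] I.
by rewrite setTI; congr (measurable _); apply/seteqP; split.
Qed.

Lemma measurable_bool_set (f : M -> bool) :
  measurable [set m | f m] -> measurable_fun setT f.
Proof.
move=> mf; apply: (measurable_fun_bool true).
by rewrite setTI; congr (measurable _): mf; apply/seteqP; split.
Qed.

Lemma measurable_set_ler (f g : M -> R) :
  measurable_fun setT f -> measurable_fun setT g -> measurable [set m | f m <= g m].
Proof. by move=> mf mg; apply: measurable_set_bool; exact: measurable_fun_ler. Qed.

Lemma measurable_set_ltr (f g : M -> R) :
  measurable_fun setT f -> measurable_fun setT g -> measurable [set m | f m < g m].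
Proof. by move=> mf mg; apply: measurable_set_bool; exact: measurable_fun_ltr. Qed.

End MeasurableSets.

Section Splice.
Context {d : measure_display} {T : measurableType d} {R : realType}.
Variable P : probability T R.
Local Open Scope ereal_scope.

(** [T] with a smaller sigma-algebra, as a space of its own: measurability with respect to a
    sub-sigma-algebra, and joint measurability for two of them, become ordinary measurability. *)
Definition sigmaT (G : set (set T)) : measurableType G.-sigma :=
  g_sigma_algebraType G.

Lemma measurable_id_sub (G : set (set T)) : G `<=` measurable ->
  measurable_fun setT (id : T -> sigmaT G).
Proof.
by move=> mG _ Y mY; rewrite setTI; exact: (g_sigma_measurable mG).
Qed.

(** The law of the pair is the product of the two laws, and Tonelli applies. *)
Lemma indep_integral_pair (d0 d1 : measure_display) (T0 : measurableType d0)
    (T1 : measurableType d1) (Z0 : {mfun T >-> T0}) (Z1 : {mfun T >-> T1})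
    (f : T0 * T1 -> \bar R) :
  (forall A B, measurable A -> measurable B ->
    P (Z0 @^-1` A `&` Z1 @^-1` B) = P (Z0 @^-1` A) * P (Z1 @^-1` B)) ->
  measurable_fun setT f -> (forall z, 0 <= f z) ->
  \int[P]_w f (Z0 w, Z1 w) = \int[P]_w0 \int[P]_w1 f (Z0 w0, Z1 w1).
Proof.
move=> ind mf f0.
have mi : measurable_fun setT (fun w : T => (Z0 w, Z1 w)).
  by apply/measurable_fun_pairP; split.
pose Z2 : {mfun T >-> (T0 * T1)%type} :=
  HB.pack (fun w : T => (Z0 w, Z1 w)) (isMeasurableFun.Build _ _ _ _ _ mi).
pose P0 : probability T0 R := distribution P Z0.
pose P1 : probability T1 R := distribution P Z1.
pose P2 : probability (T0 * T1)%type R := distribution P Z2.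
have -> : \int[P]_w f (Z0 w, Z1 w) = \int[P2]_z f z.
  by rewrite (ge0_integral_pushforward mi)// preimage_setT.
rewrite (eq_measure_integral (P0 \x P1)%E); last first.
  by move=> A mA _; apply/esym/product_measure_unique.
rewrite fubini_tonelli1// /fubini_F.
rewrite (ge0_integral_pushforward (measurable_funP Z0))//; last 2 first.
- exact: measurable_fun_fubini_tonelli_F.
- by move=> w _; exact: integral_ge0.
rewrite preimage_setT; apply: eq_integral => w0 _ /=.
rewrite (ge0_integral_pushforward (measurable_funP Z1))// ?preimage_setT//.
exact: measurableT_comp.
Qed.

(** The decoupling principle. The random variables are the two identity maps from [T] to [T] with a
    smaller sigma-algebra, so one sample point on the diagonal is replaced by two independent
    ones. *)
Lemma indep_integral_diag (G0 G1 : set (set T)) (f : sigmaT G0 * sigmaT G1 -> \bar R) :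
  G0 `<=` measurable -> G1 `<=` measurable ->
  indep P <<s G0 >> <<s G1 >> ->
  measurable_fun setT f -> (forall z, 0 <= f z) ->
  \int[P]_w f (w, w) = \int[P]_w0 \int[P]_w1 f (w0, w1).
Proof.
move=> m0 m1 ind mf f0.
pose i0 : {mfun T >-> sigmaT G0} :=
  HB.pack (id : T -> sigmaT G0) (isMeasurableFun.Build _ _ _ _ _ (measurable_id_sub m0)).
pose i1 : {mfun T >-> sigmaT G1} :=
  HB.pack (id : T -> sigmaT G1) (isMeasurableFun.Build _ _ _ _ _ (measurable_id_sub m1)).
by apply: (@indep_integral_pair _ _ _ _ i0 i1 f) => // A B mA mB; exact: ind.
Qed.

End Splice.

(* A path-continuous process is evaluated at a random time by rounding the time
   down to a grid of mesh [1/(n+1)]. *)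
Lemma measurable_eval_process (d : measure_display) (M : measurableType d)
    (R : realType) (Z : R -> M -> R) (theta : M -> R) :
  (forall a, 0 <= a -> measurable_fun setT (Z a)) ->
  (forall m, {within [set a : R | 0 <= a], continuous (Z ^~ m)}) ->
  measurable_fun setT theta -> (forall m, 0 <= theta m) ->
  measurable_fun setT (fun m => Z (theta m) m).
Proof.
move=> mZ cZ mt t0.
pose k (n : nat) m := Num.truncn (n.+1%:R * theta m).
pose g (n : nat) m : R := (k n m)%:R / n.+1%:R.
have kP (n : nat) m : (k n m)%:R <= n.+1%:R * theta m < (k n m).+1%:R.
  by apply: truncn_itv; rewrite mulr_ge0.
apply: (@measurable_fun_cvg _ _ _ _ (fun n m => Z (g n m) m)).
  move=> n _ Y mY; rewrite setTI.
  have -> : (fun m => Z (g n m) m) @^-1` Y = \bigcup_j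
      ([set m | j%:R <= n.+1%:R * theta m] `&` [set m | n.+1%:R * theta m < j.+1%:R]
        `&` (Z (j%:R / n.+1%:R) @^-1` Y)).
    apply/seteqP; split=> m /=.
      by move=> Ym; exists (k n m) => //; have /andP[] := kP n m.
    case=> j _ [[/= j1 j2] Yj].
    suff -> : g n m = j%:R / n.+1%:R by [].
    rewrite /g; congr (_%:R / _); rewrite /k.
    by apply: truncn_def; rewrite j1.
  apply: bigcupT_measurable => j; apply: measurableI; last first.
    by rewrite -[X in measurable X]setTI; apply: mZ => //; rewrite divr_ge0.
  have ms : measurable_fun setT (fun m => n.+1%:R * theta m) by exact: measurable_funM.
  by apply: measurableI; [exact: measurable_set_ler|exact: measurable_set_ltr].
move=> m _.
have gt : g ^~ m @ \oo --> theta m.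
  apply/cvgrPdist_lt => e e0; near=> n.
  have n0 : (0 < n.+1%:R :> R)%R by [].
  have /andP[h1 h2] := kP n m.
  rewrite ger0_norm; last by rewrite subr_ge0 /g ler_pdivrMr// mulrC.
  rewrite ltrBlDr /g -(ltr_pM2r n0) mulrDl divfK ?gt_eqF// mulrC.
  apply: lt_le_trans h2 _; rewrite -natr1 addrC lerD2r -ler_pdivrMr// mul1r.
  by apply: ltW; near: n; exact: (near_infty_natSinv_lt (PosNum e0)).
have /subspace_continuousP/(_ _ (t0 m)) c := cZ m.
apply: (cvg_comp _ _ _ c) => /=.
move=> A /= [e e0 eA]; near=> n; apply: eA.
  by near: n; move/cvgrPdist_lt : gt; exact.
by rewrite /= /g divr_ge0.
Unshelve. all: end_near. Qed.

(** * Deterministic genealogy, and the tree seen from a particle alive at time [r] *)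

Section Genealogy.
Context {R : realType}.
Implicit Types (l : particle -> R) (b : particle -> R -> R) (u v q : particle).

Let sum_nat_shift (F : nat -> R) (a m n : nat) :
  \sum_(a + m <= i < a + n) F i = \sum_(m <= j < n) F (a + j)%N.
Proof.
by rewrite addnC big_addn addKn; apply: eq_bigr => i _; rewrite addnC.
Qed.

(** These versions of [birth], [lived], [position] and [alive] take the lifetimes and displacements
    as arguments, so that they apply to a shifted tree as well as to a sample point. *)
Definition rbirth l u : R := \sum_(i < size u) l (take i u).
Definition rlived l u (s : R) : R := Num.max 0 (Num.min (s - rbirth l u) (l u)).
Definition rposition l b u (s : R) : R :=
  \sum_(i < (size u).+1) b (take i u) (rlived l (take i u) s).
Definition ralive l (s : R) u : bool := rbirth l u <= s < rbirth l u + l u.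

Definition reaches l b (s x : R) : Prop :=
  exists u, ralive l s u /\ x <= rposition l b u s.

(* Lifetimes and displacements seen from [v] when it has age [beta]. *)
Definition shift_life v (beta : R) l : particle -> R :=
  fun q => if nilp q then l v - beta else l (v ++ q).
Definition shift_disp v (beta : R) b : particle -> R -> R :=
  fun q a => if nilp q then b v (beta + a) - b v beta else b (v ++ q) a.

Lemma rbirth_nil l : rbirth l [::] = 0.
Proof. by rewrite /rbirth big_ord0. Qed.

Lemma rbirth_take l u k : (k <= size u)%N ->
  rbirth l (take k u) = \sum_(i < k) l (take i u).
Proof.
move=> ku; rewrite /rbirth size_takel//; apply: eq_bigr => i _.
by rewrite take_takel// ltnW.
Qed.

Lemma rbirth_takeS l u k : (k < size u)%N ->
  rbirth l (take k.+1 u) = rbirth l (take k u) + l (take k u).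
Proof. by move=> ku; rewrite (rbirth_take _ ku) (rbirth_take _ (ltnW ku)) big_ord_recr. Qed.

Lemma rbirth_cat l v q : ~~ nilp q ->
  rbirth l (v ++ q) = rbirth l v + l v + \sum_(1 <= j < size q) l (v ++ take j q).
Proof.
move=> q0; have sq : (0 < size q)%N by rewrite lt0n.
rewrite /rbirth size_cat -!(big_mkord xpredT (fun i => l (take i _))).
rewrite (big_cat_nat (n := size v)) ?leq_addr//=.
rewrite -addrA; congr (_ + _).
  by apply: eq_big_nat => i /andP[_ iv]; rewrite take_cat iv.
have := sum_nat_shift (fun i => l (take i (v ++ q))) (size v) 0 (size q).
rewrite addn0 => ->; rewrite (big_ltn sq) addn0.
rewrite take_cat ltnn subnn take0 cats0; congr (_ + _).
by apply: eq_big_nat => i _; rewrite take_cat ltnNge leq_addr/= addKn.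
Qed.

Lemma rbirth_shift l v q (beta : R) : ~~ nilp q ->
  rbirth l (v ++ q) = rbirth l v + beta + rbirth (shift_life v beta l) q.
Proof.
move=> q0; have sq : (0 < size q)%N by rewrite lt0n.
rewrite rbirth_cat// /rbirth -!(big_mkord xpredT (fun i => _ (take i _))) (big_ltn sq).
rewrite [in RHS]/shift_life take0/=.
have -> : \sum_(1 <= j < size q) l (v ++ take j q) =
    \sum_(1 <= j < size q) shift_life v beta l (take j q).
  apply: eq_big_nat => i /andP[i1 iq].
  by rewrite /shift_life /nilp size_takel ?(ltnW iq)// -leqn0 leqNgt i1.
rewrite /shift_life; ring.
Qed.

Section NonnegativeLifetimes.
Variable l : particle -> R.
Hypothesis l0 : forall u, 0 <= l u.

Lemma rbirth_ge0 u : 0 <= rbirth l u.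
Proof. exact: sumr_ge0. Qed.

Lemma rbirth_take_le u i j : (i <= j <= size u)%N ->
  rbirth l (take i u) <= rbirth l (take j u).
Proof.
move=> /andP[ij ju]; rewrite !rbirth_take ?(leq_trans ij)//.
rewrite -!(big_mkord xpredT (fun i => l (take i u))).
by rewrite (big_cat_nat (n := i) (p := j))//= lerDl sumr_ge0.
Qed.

Lemma rdeath_take_le u i j : (i < j <= size u)%N ->
  rbirth l (take i u) + l (take i u) <= rbirth l (take j u).
Proof.
move=> /andP[ij ju]; rewrite -rbirth_takeS ?(leq_trans ij)//.
by apply: rbirth_take_le; rewrite ij.
Qed.

Lemma ralive_take_inj r u i j : (i <= size u)%N -> (j <= size u)%N ->
  ralive l r (take i u) -> ralive l r (take j u) -> i = j.
Proof.
wlog ij : i j / (i < j)%N => [wl|].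
  case: (ltngtP i j) => // h iu ju ai aj; first exact: wl.
  by apply/esym/wl.
move=> iu ju /andP[_ h1] /andP[h2 _].
have := @rdeath_take_le u i j; rewrite ij ju => /(_ isT) h3.
by have := lt_le_trans h1 (le_trans h3 h2); rewrite ltxx.
Qed.

(** Along an ancestral line the life intervals, closed on the left and open on the right, are
    disjoint. *)
Lemma ralive_prefix_eq r u v :
  prefix u v -> ralive l r u -> ralive l r v -> u = v.
Proof.
rewrite prefixE => /eqP uv au av; have [h|h] := leqP (size u) (size v).
  have := @ralive_take_inj r v (size u) (size v) h (leqnn _).
  by rewrite uv take_size => /(_ au av) e; rewrite -uv e take_size.
by rewrite -uv take_oversize// ltnW.
Qed.

End NonnegativeLifetimes.

(** The first particle on the line that dies after [r] is born at the death of its parent, which is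
    at most [r] by minimality. *)
Lemma ralive_ancestor l r s u : 0 <= r -> r <= s -> ralive l s u ->
  exists k, (k <= size u)%N /\ ralive l r (take k u).
Proof.
move=> r0 rs /andP[_ su].
have ex : exists k, r < rbirth l (take k u) + l (take k u).
  by exists (size u); rewrite take_size (le_lt_trans rs).
case: (ex_minnP ex) => k hk mk; exists k; split.
  by apply: mk; rewrite take_size (le_lt_trans rs).
rewrite /ralive hk andbT; case: k => [|k] in hk mk *.
  by rewrite take0 rbirth_nil.
have ku : (k < size u)%N.
  by apply: mk; rewrite take_size (le_lt_trans rs).
rewrite rbirth_takeS//; rewrite leNgt; apply/negP => /mk; by rewrite ltnn.
Qed.

Lemma rposition_split l b v q s :
  rposition l b (v ++ q) s = rposition l b v s +
    \sum_(1 <= j < (size q).+1) b (v ++ take j q) (rlived l (v ++ take j q) s).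
Proof.
rewrite /rposition size_cat.
rewrite -!(big_mkord xpredT (fun i => b (take i _) (rlived l (take i _) s))).
rewrite (big_cat_nat (n := (size v).+1)) ?ltnS ?leq_addr//=; congr (_ + _).
  apply: eq_big_nat => i /andP[_ iv].
  by rewrite takel_cat.
have := sum_nat_shift
  (fun i => b (take i (v ++ q)) (rlived l (take i (v ++ q)) s)) (size v) 1 (size q).+1.
rewrite addn1 addnS => ->.
by apply: eq_big_nat => i _; rewrite take_cat ltnNge leq_addr/= addKn.
Qed.

(** Up to the death of [v] its descendants have lived for time 0 and contribute [b u 0]. *)
Lemma rposition_cat_early l b v q a : (forall u, 0 <= l u) ->
  (forall u, b u 0 = 0) -> a <= rbirth l v + l v ->
  rposition l b (v ++ q) a = rposition l b v a.
Proof.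
move=> l0 b0 av; rewrite rposition_split big_nat big1 ?addr0// => j /andP[j1 jq].
suff -> : rlived l (v ++ take j q) a = 0 by [].
apply/max_idPl; rewrite ge_min subr_le0; apply/orP; left.
apply: le_trans av _.
rewrite rbirth_cat; last by rewrite /nilp size_takel// -leqn0 leqNgt j1.
by rewrite lerDl sumr_ge0.
Qed.

Section ShiftAtAge.
Variables (l : particle -> R) (b : particle -> R -> R) (v : particle) (r s : R).
Hypotheses (l0 : forall u, 0 <= l u) (rs : r <= s) (av : ralive l r v).
Let beta := r - rbirth l v.

Lemma ralive_shift q :
  ralive l s (v ++ q) = ralive (shift_life v beta l) (s - r) q.
Proof.
case: (boolP (nilp q)) => [/nilP ->|q0].
  rewrite cats0 /ralive rbirth_nil add0r /shift_life/= subr_ge0 rs.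
  have /andP[h _] := av; rewrite (le_trans h rs)/=.
  by rewrite /beta ltrBlDr opprB addrA subrK addrC.
rewrite /ralive (rbirth_shift l v beta q0) /beta subrKC.
rewrite [in RHS]/shift_life (negPf q0) lerBrDl ltrBlDl.
by rewrite addrA.
Qed.

Lemma rlived_shift q : ~~ nilp q ->
  rlived l (v ++ q) s = rlived (shift_life v beta l) q (s - r).
Proof.
move=> q0; rewrite /rlived (rbirth_shift l v beta q0) /beta subrKC.
by rewrite [in RHS]/shift_life (negPf q0) opprD addrA.
Qed.

(** The strict ancestors of [v] have spent their whole lifetime by time [r] and contribute the same
    at time [s]; the displacement of [v] is cut at age [beta], and its second half becomes the
    displacement of the root of the shifted tree. *)
Lemma rposition_shift q :
  rposition l b (v ++ q) s =
  rposition l b v r + rposition (shift_life v beta l) (shift_disp v beta b) q (s - r).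
Proof.
rewrite rposition_split [X in _ = _ + X]/rposition.
rewrite -[in RHS](big_mkord xpredT
  (fun i => shift_disp v beta b (take i q)
     (rlived (shift_life v beta l) (take i q) (s - r)))).
rewrite [in RHS]big_ltn// [RHS]addrA; congr (_ + _); last first.
  apply: eq_big_nat => j /andP[j1 jq].
  have tj : ~~ nilp (take j q) by rewrite /nilp size_takel// -leqn0 leqNgt j1.
  by rewrite rlived_shift// /shift_disp (negPf tj).
have /andP[av1 av2] := av.
rewrite take0 /shift_disp/= /rposition !big_ord_recr/= -addrA; congr (_ + _).
  apply: eq_bigr => i _; congr (b _ _).
  have h := rdeath_take_le l0 (i := i) (j := size v) (u := v).
  rewrite ltn_ord leqnn take_size in h.
  have {}h := le_trans (h isT) av1.
  rewrite /rlived !min_r//; rewrite lerBrDl//.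
  exact: le_trans rs.
have lr : rlived l (take (size v) v) r = beta.
  rewrite take_size /rlived min_l ?max_r// ?subr_ge0//.
  by rewrite lerBlDl ltW.
rewrite lr take_size addrCA subrr addr0; congr (b _ _).
rewrite /rlived rbirth_nil /shift_life/= subr0.
have h0 : 0 <= l v - beta by rewrite subr_ge0 /beta lerBlDl ltW.
rewrite max_r; last by rewrite le_min subr_ge0 (le_trans av1)//=.
rewrite max_r; last by rewrite le_min subr_ge0 rs.
(* The age of [v] at time [s], capped by its lifetime, is [beta] plus the minimum of [s - r] and the
   residual lifetime. *)
by rewrite [in RHS]addr_minr /beta; congr Num.min; ring.
Qed.

Lemma reaches_shift x :
  (exists q, ralive l s (v ++ q) /\ x <= rposition l b (v ++ q) s) <->
  reaches (shift_life v beta l) (shift_disp v beta b) (s - r)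
    (x - rposition l b v r).
Proof.
by split=> -[q [h1 h2]]; exists q; move: h1 h2;
  rewrite ralive_shift rposition_shift lerBlDl.
Qed.

End ShiftAtAge.
End Genealogy.

(** * Measurability of genealogical quantities *)

Section MeasurableGenealogy.
Context {d : measure_display} {M : measurableType d} {R : realType}.
Implicit Types (l : particle -> M -> R) (b : particle -> R -> M -> R).

Definition continuous_paths (Z : R -> M -> R) : Prop :=
  forall m, {within [set a : R | 0 <= a], continuous (Z ^~ m)}.

Lemma measurable_rbirth l u :
  (forall i, (i < size u)%N -> measurable_fun setT (l (take i u))) ->
  measurable_fun setT (fun m => rbirth (l ^~ m) u).
Proof. by move=> ml; apply: measurable_sum => i; exact: ml. Qed.

Lemma measurable_ralive l u (s : R) :
  (forall i, (i <= size u)%N -> measurable_fun setT (l (take i u))) ->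
  measurable [set m | ralive (l ^~ m) s u].
Proof.
move=> ml; have mb : measurable_fun setT (fun m => rbirth (l ^~ m) u).
  by apply: measurable_rbirth => i /ltnW; exact: ml.
have ml' : measurable_fun setT (l u) by rewrite -[u]take_size; exact: ml.
have -> : [set m | ralive (l ^~ m) s u] = [set m | rbirth (l ^~ m) u <= s] `&`
    [set m | s < rbirth (l ^~ m) u + l u m].
  by apply/seteqP; split=> [m /andP//|m /= [h1 h2]]; rewrite /ralive h1.
apply: measurableI; first exact: measurable_set_ler.
by apply: measurable_set_ltr => //; exact: measurable_funD.
Qed.

Lemma measurable_rposition l b u (s : R) :
  (forall i, (i <= size u)%N -> measurable_fun setT (l (take i u))) ->
  (forall i a, (i <= size u)%N -> 0 <= a -> measurable_fun setT (b (take i u) a)) ->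
  (forall i, (i <= size u)%N -> continuous_paths (b (take i u))) ->
  measurable_fun setT (fun m => rposition (l ^~ m) (fun u a => b u a m) u s).
Proof.
move=> ml mb cb; apply: measurable_sum => -[i /= iu].
apply: (@measurable_eval_process _ _ _ (b (take i u))).
- by move=> a; exact: mb.
- exact: cb.
- apply: measurable_maxr => //; apply: measurable_minr; last exact: ml.
  apply: measurable_funB => //; apply: measurable_rbirth => j ji.
  move: ji; rewrite size_takel// => ji; rewrite take_takel 1?ltnW//.
  by apply: ml; rewrite ltnW// (leq_trans ji).
- by move=> m; rewrite le_max lexx.
Qed.

Lemma measurable_reaches l b (s : R) (x : M -> R) :
  (forall u, measurable_fun setT (l u)) ->
  (forall u a, 0 <= a -> measurable_fun setT (b u a)) ->
  (forall u, continuous_paths (b u)) -> measurable_fun setT x ->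
  measurable [set m | reaches (l ^~ m) (fun u a => b u a m) s (x m)].
Proof.
move=> ml mb cb mx.
have -> : [set m | reaches (l ^~ m) (fun u a => b u a m) s (x m)] =
    \bigcup_u ([set m | ralive (l ^~ m) s u] `&`
      [set m | x m <= rposition (l ^~ m) (fun u a => b u a m) u s]).
  by apply/seteqP; split=> m /= [u h]; exists u => //; case: h.
apply: countable_bigcupT_measurable => [|u]; first exact: countableP.
apply: measurableI; first exact: measurable_ralive.
by apply: measurable_set_ler => //; apply: measurable_rposition => *;
  [exact: ml|exact: mb|exact: cb].
Qed.

Lemma continuous_paths_shift (Z : R -> M -> R) (beta : M -> R) :
  continuous_paths Z -> (forall m, 0 <= beta m) ->
  continuous_paths (fun a m => Z (beta m + a) m - Z (beta m) m).
Proof.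
move=> cZ b0 m; apply/subspace_continuousP => a /= a0.
apply: cvgB; last exact: cvg_cst.
have /subspace_continuousP/(_ (beta m + a)) c := cZ m.
have {}c : Z x m @[x --> within [set a | 0 <= a] (nbhs (beta m + a))] --> Z (beta m + a) m.
  by apply: c; rewrite /= addr_ge0.
apply: (cvg_comp _ _ _ c) => A /=; rewrite !nbhs_simpl/= => -[e e0 eA].
exists e => // y /= ye y0; apply: eA; last by rewrite /= addr_ge0.
by rewrite /ball_/= opprD addrACA subrr add0r.
Qed.

Lemma measurable_increment (Z : R -> M -> R) (beta : M -> R) (a : R) :
  (forall a, 0 <= a -> measurable_fun setT (Z a)) -> continuous_paths Z ->
  measurable_fun setT beta -> (forall m, 0 <= beta m) -> 0 <= a ->
  measurable_fun setT (fun m => Z (beta m + a) m - Z (beta m) m).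
Proof.
move=> mZ cZ mb b0 a0; apply: measurable_funB; last exact: measurable_eval_process.
apply: (@measurable_eval_process _ _ _ Z (fun m => beta m + a)) => //.
  exact: measurable_funD.
by move=> m; rewrite addr_ge0.
Qed.

(** Of the motion of [v] only the increments after [beta] have to be measurable, so the lemma
    applies to sigma-algebras that do not see the motion before that age. *)
Lemma measurable_reaches_shift l b v (s : R) (beta x : M -> R) :
  (forall q, measurable_fun setT (l (v ++ q))) ->
  (forall q a, ~~ nilp q -> 0 <= a -> measurable_fun setT (b (v ++ q) a)) ->
  (forall a, 0 <= a ->
    measurable_fun setT (fun m => b v (beta m + a) m - b v (beta m) m)) ->
  (forall q, continuous_paths (b (v ++ q))) ->
  measurable_fun setT beta -> (forall m, 0 <= beta m) -> measurable_fun setT x ->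
  measurable [set m | reaches (shift_life v (beta m) (l ^~ m))
    (shift_disp v (beta m) (fun u a => b u a m)) s (x m)].
Proof.
move=> ml mb mbv cb mbeta b0 mx.
apply: (@measurable_reaches (fun q m => shift_life v (beta m) (l ^~ m) q)
  (fun q a m => shift_disp v (beta m) (fun u a => b u a m) q a)) => //.
- move=> q; rewrite /shift_life; case: nilp; last exact: ml.
  by apply: measurable_funB => //; have := ml [::]; rewrite cats0.
- move=> q a a0; rewrite /shift_disp; case: (boolP (nilp q)) => q0; first exact: mbv.
  exact: mb.
- move=> q; rewrite /shift_disp; case: (boolP (nilp q)) => q0; last exact: cb.
  by apply: continuous_paths_shift => //; have := cb [::]; rewrite cats0.
Qed.

End MeasurableGenealogy.

(** * The inequality for events at distinct coordinates *)

Section DisjointOccurrence.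
Context {R : realDomainType} {I : eqType}.
Implicit Types (V : seq I).

(* [a], [b], [n], [c] are the probabilities of "not A", "not B", "neither",
   "both" at each coordinate.  Replacing [a * b] by [min (a * b) n] makes the
   one-coordinate comparison of [n] with [a * b] monotone along the product. *)
Lemma prod_neither_le V (a b n c : I -> R) : uniq V ->
  (forall v, [/\ 0 <= a v <= 1, 0 <= b v <= 1, 0 <= n v & 0 <= c v]) ->
  (forall v, c v = 1 - a v - b v + n v) ->
  \prod_(v <- V) n v <= (\prod_(v <- V) a v) * (\prod_(v <- V) b v) +
    \sum_(v <- V) c v * \prod_(w <- V | w != v) n w.
Proof.
move=> uV h cE; pose m v := Num.min (a v * b v) (n v).
have m0 v : 0 <= m v.
  by have [/andP[? _] /andP[? _] ? _] := h v; rewrite le_min mulr_ge0.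
have mn v : m v <= n v by rewrite ge_min lexx orbT.
have nmc v : n v - m v <= c v.
  have [/andP[a0 a1] /andP[b0 b1] n0 c0] := h v.
  rewrite /m; case: (leP (a v * b v) (n v)) => _; last by rewrite subrr.
  (* When [a v * b v] is the minimum, [c v] exceeds [n v - a v * b v] by exactly this product. *)
  rewrite cE; have : 0 <= (1 - a v) * (1 - b v) by rewrite mulr_ge0 ?subr_ge0.
  by rewrite mulrBl !mulrBr !mul1r !mulr1; lra.
have -> : (\prod_(v <- V) a v) * (\prod_(v <- V) b v) = \prod_(v <- V) (a v * b v).
  by rewrite big_split.
apply: (@le_trans _ _ (\prod_(v <- V) m v +
    \sum_(v <- V) c v * \prod_(w <- V | w != v) n w)); last first.
  rewrite lerD2r; apply: ler_prod => v _.
  by rewrite m0/= ge_min lexx.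
elim: V uV => [|u V IH]/=; first by rewrite !big_nil addr0.
move=> /andP[uV /IH{}IH]; rewrite !big_cons eqxx/=.
rewrite -[X in _ <= _ + (_ * X + _)](_ : \prod_(w <- V) n w = _); last first.
  rewrite big_seq [RHS]big_seq_cond; apply: eq_bigl => w.
  by case wV: (w \in V) => //=; apply/esym/eqP => wu; rewrite -wu wV in uV.
have -> : \sum_(v <- V) c v * \prod_(w <- u :: V | w != v) n w =
    n u * \sum_(v <- V) c v * \prod_(w <- V | w != v) n w.
  rewrite big_seq [in RHS]big_seq mulr_sumr; apply: eq_bigr => v vV.
  rewrite big_cons; case: eqP => [uv|_]; first by rewrite uv vV in uV.
  by rewrite mulrCA.
have [_ _ n0 c0] := h u.
apply: le_trans (ler_wpM2l n0 IH) _; rewrite mulrDr addrA lerD2r.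
(* What remains is [(n u - m u)] times the product of the [m v] against [c u] times the product of
   the [n v]; both factors are compared separately. *)
rewrite -lerBlDl -mulrBl.
apply: (@le_trans _ _ ((n u - m u) * \prod_(v <- V) n v)).
  by apply: ler_wpM2l; [rewrite subr_ge0|apply: ler_prod => v _; rewrite m0 mn].
by apply: ler_wpM2r => //; apply: prodr_ge0 => v _; case: (h v).
Qed.

Lemma prod_bool V (p : I -> bool) : \prod_(v <- V) (p v)%:R = (all p V)%:R :> R.
Proof.
elim: V => [|u V IH]; first by rewrite big_nil.
by rewrite big_cons IH/=; case: (p u); rewrite ?mul1r ?mul0r.
Qed.

(** Disjoint occurrence in the sense of the van den Berg-Kesten inequality, with one coordinate as
    witness for each event. *)
Definition disj_occur V (A B : pred I) : bool :=
  has (fun v => A v && has (fun w => (w != v) && B w) V) V.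

(** Disjoint occurrence fails exactly when there is no [A], or no [B], or a single coordinate
    carries all of them and carries both. The first two cases overlap in the case of neither, the
    third is disjoint from them. In expectation, [prod_neither_le] then turns this into the bound
    [(1 - a) * (1 - b)], where [a] and [b] are the products of the miss probabilities. *)
Lemma disj_occur_le V (A B : pred I) : uniq V ->
  (disj_occur V A B)%:R + \prod_(v <- V) (~~ A v)%:R + \prod_(v <- V) (~~ B v)%:R +
    \sum_(v <- V) (A v && B v)%:R * \prod_(w <- V | w != v) (~~ A w && ~~ B w)%:R
  <= 1 + \prod_(v <- V) (~~ A v && ~~ B v)%:R :> R.
Proof.
move=> uV; rewrite !prod_bool.
have sing v : v \in V -> (A v && B v)%:R * \prod_(w <- V | w != v) (~~ A w && ~~ B w)%:R =
    (A v && B v && all (fun w => (w != v) ==> ~~ A w && ~~ B w) V)%:R :> R.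
  move=> vV; rewrite big_mkcond/=.
  rewrite (eq_bigr (fun w => ((w != v) ==> ~~ A w && ~~ B w)%:R)); last first.
    by move=> w _; case: (w != v).
  by rewrite prod_bool -natrM mulnb.
rewrite big_seq (eq_bigr _ sing) -big_seq.
set S := \sum_(v <- V) _.
have [/hasP[v0 v0V v0S]|noS] := boolP (has (fun v => A v && B v &&
  all (fun w => (w != v) ==> ~~ A w && ~~ B w) V) V).
- case/andP: v0S => /andP[Av Bv] /allP al.
  have -> : S = 1.
    rewrite /S (bigD1_seq v0)//= Av Bv big1_seq; last first.
      move=> w /andP[wv wV]; have := al w wV; rewrite wv => /andP[/negPf -> _].
      by [].
    by rewrite addr0; have -> : all (fun w => (w != v0) ==> ~~ A w && ~~ B w) V by apply/allP.
  have -> : all (fun v => ~~ A v) V = false.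
    by apply/negbTE/allPn; exists v0 => //; rewrite Av.
  have -> : all (fun v => ~~ B v) V = false.
    by apply/negbTE/allPn; exists v0 => //; rewrite Bv.
  have -> : all (fun v => ~~ A v && ~~ B v) V = false.
    by apply/negbTE/allPn; exists v0 => //; rewrite Av.
  have -> : disj_occur V A B = false.
    apply/negbTE/hasPn => w wV; rewrite negb_and.
    have [->|wv] := eqVneq w v0.
      apply/orP; right; apply/hasPn => z zV; rewrite negb_and negbK.
      case: eqVneq => //= zv; have := al z zV; by rewrite zv => /andP[].
    by have := al w wV; rewrite wv => /andP[-> _].
  by rewrite !add0r addr0.
- have -> : S = 0.
    by rewrite /S big1_seq// => v /andP[_ vV]; rewrite (negbTE (hasPn noS v vV)).
  rewrite addr0; case nA: (all (fun v => ~~ A v) V); case nB: (all (fun v => ~~ B v) V).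
  + have -> : all (fun v => ~~ A v && ~~ B v) V by rewrite all_predI nA nB.
    have -> : disj_occur V A B = false.
      by apply/negbTE/hasPn => w wV; rewrite negb_and (allP nA).
    by rewrite add0r.
  + have -> : disj_occur V A B = false.
      by apply/negbTE/hasPn => w wV; rewrite negb_and (allP nA).
    by rewrite add0r addr0 lerDl.
  + have -> : disj_occur V A B = false.
      apply/negbTE/hasPn => w wV; rewrite negb_and; apply/orP; right.
      by apply/hasPn => z zV; rewrite negb_and (allP nB) ?orbT.
    by rewrite !add0r lerDl.
  + rewrite !addr0; case: (disj_occur _ _ _); by rewrite ?lerDl// addr_ge0.
Qed.

End DisjointOccurrence.

(** * Comparison of functions measurable for a sub-sigma-algebra *)

Section ConditionalProbability.
Context {d : measure_display} {T : measurableType d} {R : realType}.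
Variable P : probability T R.
Local Open Scope ereal_scope.

(** The hypothesis is tested on the set where the conclusion fails, which belongs to the
    sub-sigma-algebra. *)
Lemma ae_le_sub_sigma (C : set (set T)) (f g : T -> R) : C `<=` measurable ->
  measurable_fun setT (f : sigmaT C -> R) -> measurable_fun setT (g : sigmaT C -> R) ->
  P.-integrable setT (EFin \o f) -> P.-integrable setT (EFin \o g) ->
  (forall E, <<s C >> E -> \int[P]_(w in E) (f w)%:E <= \int[P]_(w in E) (g w)%:E) ->
  {ae P, forall w, (f w <= g w)%R}.
Proof.
move=> mC mf mg If Ig h.
pose E := [set w | (g w < f w)%R].
have GE : <<s C >> E by exact: (@measurable_set_ltr _ (sigmaT C) _ _ _ mg mf).
have mE := g_sigma_measurable mC GE.
have IfE : P.-integrable E (EFin \o f) by exact: integrableS If.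
have IgE : P.-integrable E (EFin \o g) by exact: integrableS Ig.
have IE : P.-integrable E (fun w => (f w)%:E - (g w)%:E) by exact: integrableB.
have z : \int[P]_(w in E) `|(f w)%:E - (g w)%:E| = 0.
  apply/eqP; rewrite eq_le integral_ge0// andbT.
  rewrite (eq_integral (fun w => (f w)%:E - (g w)%:E)); last first.
    move=> w; rewrite inE => wE; rewrite gee0_abs//.
    by rewrite -EFinB lee_fin subr_ge0 ltW.
  rewrite integralB//= sube_le0.
  exact: h.
have := (ae_eq_integral_abs P mE (measurable_int _ IE)).1 z.
apply: filterS => w /= hw; rewrite leNgt; apply/negP => wE.
by have := hw wE; rewrite -EFinB => -[] /eqP; rewrite subr_eq0 gt_eqF.
Qed.

End ConditionalProbability.

Section SubSigmaMeasurability.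
Context {d : measure_display} {T : measurableType d} {R : realType}.

Lemma measurable_sigmaT (C : set (set T)) (X : T -> R) :
  (forall Y, measurable Y -> <<s C >> (X @^-1` Y)) ->
  measurable_fun setT (X : sigmaT C -> R).
Proof. by move=> h _ Y mY; rewrite setTI; exact: h. Qed.

Lemma sigmaT_measurable (C : set (set T)) (X : T -> R) :
  measurable_fun setT (X : sigmaT C -> R) ->
  forall Y, measurable Y -> <<s C >> (X @^-1` Y).
Proof. by move=> h Y mY; rewrite -[_ @^-1` _]setTI; exact: h. Qed.

Lemma measurable_sigmaT_sub (C D : set (set T)) (X : T -> R) : C `<=` <<s D >> ->
  measurable_fun setT (X : sigmaT C -> R) -> measurable_fun setT (X : sigmaT D -> R).
Proof.
move=> CD mX; apply: measurable_sigmaT => Y mY.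
have /= := sigmaT_measurable mX mY.
by apply: smallest_sub; [exact: smallest_sigma_algebra|].
Qed.

Lemma sigma_family_measurable (I : Type) (J : set I) (X : I -> T -> R) (i : I) :
  J i -> measurable_fun setT
    (X i : sigmaT (\bigcup_(i in J) preimage_set_system setT (X i) measurable) -> R).
Proof.
move=> Ji; apply: measurable_sigmaT => Y mY; apply: sub_sigma_algebra.
by exists i => //; exists Y => //; rewrite setTI.
Qed.

Lemma sigma_family_sub (I : Type) (J : set I) (X : I -> T -> R) (C : set (set T)) :
  (forall i, J i -> measurable_fun setT (X i : sigmaT C -> R)) ->
  sigma_family J X `<=` <<s C >>.
Proof.
move=> h; apply: smallest_sub; first exact: smallest_sigma_algebra.
by move=> _ [i Ji [Y mY <-]]; rewrite setTI; exact: (sigmaT_measurable (h i Ji)).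
Qed.

Lemma sigma_family_sub_measurable (I : Type) (J : set I) (X : I -> T -> R) :
  (forall i, J i -> measurable_fun setT (X i)) -> sigma_family J X `<=` measurable.
Proof.
move=> h; apply: g_sigma_measurable => _ [i Ji [Y mY <-]].
exact: (h i Ji measurableT Y mY).
Qed.

End SubSigmaMeasurability.

(** * Brownian motion before and after a fixed age *)

Section BrownianIncrements.
Context {d : measure_display} {T : measurableType d} {R : realType}.
Variable P : probability T R.
Variable W : R -> {RV P >-> R}.
Hypothesis hW : is_brownian_motion W.

Definition increment (beta a : R) : T -> R := fun w => W (beta + a) w - W beta w.

Let sigma_before (beta : R) := sigma_family [set a | 0 <= a <= beta] (fun a => W a : T -> R).
Let sigma_after (beta : R) := sigma_family [set a | 0 <= a] (increment beta).

Let index_sorted (L : seq R) a b : sorted <=%R L -> a \in L -> b \in L ->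
  a <= b -> (index a L <= index b L)%N.
Proof.
move=> sL aL bL ab; rewrite leqNgt; apply/negP => h.
have : nth 0 L (index b L) <= nth 0 L (index a L).
  by apply: (sorted_leq_nth le_trans lexx) => //; rewrite ?inE ?index_mem// ltnW.
rewrite !nth_index// => ba; have : a == b by rewrite eq_le ab.
by move=> /eqP abE; rewrite abE ltnn in h.
Qed.

(** Finitely many times on both sides of [beta] are put into one sorted list. Values up to [beta]
    are sums of the consecutive increments before the index of [beta], later increments are sums of
    those after it, and [indep_grouping] separates the two groups. *)
Lemma indep_before_after (beta : R) : 0 <= beta ->
  indep P (sigma_before beta) (sigma_after beta).
Proof.
move=> b0; have [W0 _ _ indW] := hW.
pose C0 (a : R) := preimage_set_system setT (W a) measurable.
pose C1 (a : R) := preimage_set_system setT (increment beta a) measurable.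
have CI (X : T -> R) : setI_closed (preimage_set_system setT X measurable).
  move=> _ _ [Y mY <-] [Z mZ <-]; exists (Y `&` Z); first exact: measurableI.
  by rewrite !setTI preimage_setI.
have CT (X : T -> R) : preimage_set_system setT X measurable setT.
  by exists setT => //; rewrite setTI preimage_setT.
have mC (X : T -> R) : measurable_fun setT X -> preimage_set_system setT X measurable `<=`
  measurable.
  by move=> mX _ [Y mY <-]; exact: mX.
have minc a : measurable_fun setT (increment beta a).
  by apply: measurable_funB; exact: measurable_funP.
have mfin J (X : R -> T -> R) : (forall a, measurable_fun setT (X a)) ->
    finI_from J (fun a => preimage_set_system setT (X a) measurable) `<=` measurable.
  move=> mX _ [s [F [hF ->]]]; apply: fin_bigcap_measurable => [|i /= is_].
    exact: finite_seq.
  exact: (mC _ (mX i) _ (hF i is_).2).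
have ind : indep P <<s finI_from [set a | 0 <= a <= beta] C0 >>
    <<s finI_from [set a | 0 <= a] C1 >>.
  apply: indep_g_sigma; try (apply: finI_from_setI => *; by [exact: CI|exact: CT]).
  - by apply: mfin => a; exact: measurable_funP.
  - exact: mfin.
  move=> _ _ [s [F [hF ->]]] [s' [F' [hF' ->]]].
  (* Time 0 is included to write [W a] as [W a - W 0], and [beta] so that no consecutive increment
     straddles it. *)
  pose L := sort <=%R (0 :: beta :: s ++ map (+%R beta) s').
  have sL : sorted <=%R L by apply: sort_sorted; exact: le_total.
  have L0 : 0 \in L by rewrite mem_sort !inE eqxx.
  have Lb : beta \in L by rewrite mem_sort !inE eqxx orbT.
  have Ls a : a \in s -> a \in L by rewrite mem_sort !inE mem_cat => ->; rewrite !orbT.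
  have Ls' a : a \in s' -> beta + a \in L.
    by move=> as'; rewrite mem_sort !inE mem_cat (map_f _ as') !orbT.
  have Lge a : a \in L -> 0 <= a.
    rewrite mem_sort !inE mem_cat => /or4P[/eqP->//|/eqP->//|/hF[/= /andP[]//]|].
    by case/mapP => c /hF'[/= c0 _] ->; rewrite addr_ge0.
  (* Past the end of [L] the sequence stays at the last time, as [is_brownian_motion] asks for
     infinite sequences. *)
  pose t (i : nat) := nth 0 L (minn i (size L).-1).
  have sL0 : (0 < size L)%N by case: (L) L0.
  have tidx a : a \in L -> t (index a L) = a.
    move=> aL; rewrite /t (minn_idPl _) ?nth_index//.
    by rewrite -ltnS prednK// index_mem.
  have lt_sz i : (minn i (size L).-1 < size L)%N.
    by rewrite (leq_ltn_trans (geq_minr _ _))// prednK.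
  have t0 : 0 <= t 0%N by apply: Lge; apply: mem_nth.
  have tmono : {homo t : i j / (i <= j)%N >-> i <= j}.
    move=> i j ij; apply: (sorted_leq_nth le_trans lexx) => //; rewrite ?inE//.
    by rewrite leq_min geq_minr (leq_trans (geq_minl _ _) ij).
  have := indW t t0 tmono.
  set G := (fun i => _) => indG.
  pose J0 := [set i | (i < index beta L)%N].
  pose J1 := [set i | (index beta L <= i)%N].
  have mG J i : J i -> measurable_fun setT
      ((fun w => W (t i.+1) w - W (t i) w) : sigmaT (\bigcup_(i in J) G i) -> R).
    move=> Ji; apply: measurable_sigmaT => Y mY.
    apply: sub_sigma_algebra; exists i => //.
    apply: (@sigmaT_measurable _ _ _ (\bigcup_(j in setT) preimage_set_system setT
      ((fun _ : unit => (fun w => W (t i.+1) w - W (t i) w)) j) measurable)) => //.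
    exact: (@sigma_family_measurable _ _ _ _ _ _ tt).
  have mD (J : set nat) a c : a \in L -> c \in L -> a <= c ->
      (forall i, (index a L <= i < index c L)%N -> J i) ->
      measurable_fun setT ((fun w => W c w - W a w) : sigmaT (\bigcup_(i in J) G i) -> R).
    move=> aL cL ac hJ.
    have -> : (fun w => W c w - W a w) = (fun w =>
        \sum_(index a L <= i < index c L) (W (t i.+1) w - W (t i) w)).
      apply/funext => w.
      rewrite (telescope_sumr (fun i => W (t i) w)) ?tidx//.
      exact: index_sorted.
    (* [measurable_sum] wants every term measurable, so terms outside the range are set to 0. *)
    rewrite [X in measurable_fun _ X](_ : _ = (fun w =>
        \sum_(i <- index_iota (index a L) (index c L))
          if (index a L <= i < index c L)%N then W (t i.+1) w - W (t i) w else 0)); last first.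
      by apply/funext => w; apply: eq_big_nat => i ->.
    apply: measurable_sum => i.
    by case: (boolP (index a L <= i < index c L)%N) => // hi; apply: mG; exact: hJ.
  have gE J (E : R -> set T) (r : seq R) : (forall a, a \in r -> <<s \bigcup_(i in J) G i >>
    (E a)) ->
     <<s \bigcup_(i in J) G i >> (\bigcap_(a in [set` r]) E a).
    move=> h; apply: (@fin_bigcap_measurable _ (sigmaT (\bigcup_(i in J) G i))) => [|a /= ar].
      exact: finite_seq.
    exact: h.
  apply: (@indep_grouping _ _ _ P _ G J0 J1).
  - by move=> i; exact: smallest_sigma_algebra.
  - move=> i; apply: sigma_family_sub_measurable => _ _.
    by apply: measurable_funB; exact: measurable_funP.
  - exact: indG.
  - apply/seteqP; split=> // i [/= h1 h2].
    by have := leq_trans h1 h2; rewrite ltnn.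
  - apply: gE => a as_; have [/= /andP[a0 ab] [Y mY <-]] := hF a as_.
    rewrite setTI; apply: (@sigmaT_measurable _ _ _ _ (W a)) => //.
    have -> : (W a : T -> R) = (fun w => W a w - W 0 w).
      by apply/funext => w; rewrite W0 subr0.
    apply: mD => //; first exact: Ls.
    move=> i /andP[_ ia]; apply: (leq_trans ia).
    by apply: index_sorted => //; exact: Ls.
  - apply: gE => a as_; have [/= a0 [Y mY <-]] := hF' a as_.
    rewrite setTI; apply: (@sigmaT_measurable _ _ _ _ (increment beta a)) => //.
    apply: mD => //; first exact: Ls'.
      by rewrite lerDl.
    by move=> i /andP[].
by apply: indepS ind; apply: sub_sigma_algebra2; exact: finI_from_sub.
Qed.

End BrownianIncrements.

(** * Sigma-algebras of clocks, and freezing a particle at its age *)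

Section BBMSigmaAlgebras.
Context {d : measure_display} {T : measurableType d} {R : realType}.
Variable P : probability T R.
Variables (tau : particle -> {RV P >-> R}) (B : particle -> R -> {RV P >-> R}).
Hypothesis hBBM : is_BBM tau B.

Definition clock_label (k : particle + particle) : particle :=
  match k with inl u => u | inr u => u end.

Definition clock_sigma (k : particle + particle) : set (set T) :=
  match k with
  | inl u => sigma_var (tau u)
  | inr u => sigma_family [set a : R | 0 <= a] (B u : R -> T -> R)
  end.

Definition clock_gen (J : set (particle + particle)) : set (set T) :=
  \bigcup_(k in J) clock_sigma k.

Definition outside v : set (particle + particle) :=
  [set k | ~~ prefix v (clock_label k)].
Definition inside v : set (particle + particle) :=
  [set k | prefix v (clock_label k)].

Definition motion_before v (beta : R) : set (set T) :=
  \bigcup_(a in [set a | 0 <= a <= beta]) preimage_set_system setT (B v a) measurable.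
Definition motion_after v (beta : R) : set (set T) :=
  \bigcup_(a in [set a | 0 <= a]) preimage_set_system setT (increment (B v) beta a) measurable.
(** A pi-system for what happens to the progeny of [v] after age [beta]. The index [inl v] stays in
    [inside v] with [inr v] removed, so the lifetime of [v] belongs to this future. *)
Definition after_age v (beta : R) : set (set T) :=
  [set F `&` G | F in <<s motion_after v beta >> &
                 G in <<s clock_gen (inside v `\ inr v) >>].

Lemma clock_sigma_algebra k : sigma_algebra setT (clock_sigma k).
Proof. by case: k => u; exact: smallest_sigma_algebra. Qed.

Lemma clock_sigma_measurable k : clock_sigma k `<=` measurable.
Proof.
case: k => u; apply: sigma_family_sub_measurable => i _; exact: measurable_funP.
Qed.

Lemma clock_gen_measurable J : clock_gen J `<=` measurable.
Proof. by move=> A [k _]; exact: clock_sigma_measurable. Qed.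

Lemma indep_clock_gen J0 J1 : J0 `&` J1 = set0 ->
  indep P <<s clock_gen J0 >> <<s clock_gen J1 >>.
Proof.
have [_ _ ind] := hBBM; apply: indep_grouping => //.
- exact: clock_sigma_algebra.
- exact: clock_sigma_measurable.
Qed.

Lemma measurable_tau_gen J u : J (inl u) ->
  measurable_fun setT (tau u : sigmaT (clock_gen J) -> R).
Proof.
move=> Ju; apply: measurable_sigmaT => Y mY; apply: sub_sigma_algebra.
exists (inl u) => //=.
apply: (sigmaT_measurable (@sigma_family_measurable _ _ _ _ setT (fun=> tau u : T -> R) tt I))
  => //.
Qed.

Lemma measurable_B_gen J u a : J (inr u) -> 0 <= a ->
  measurable_fun setT (B u a : sigmaT (clock_gen J) -> R).
Proof.
move=> Ju a0; apply: measurable_sigmaT => Y mY; apply: sub_sigma_algebra.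
exists (inr u) => //=.
apply: (sigmaT_measurable (@sigma_family_measurable _ _ _ _ [set a : R | 0 <= a]
  (B u : R -> T -> R) a a0)) => //.
Qed.

Lemma continuous_B u : continuous_paths (B u : R -> T -> R).
Proof. by move=> w; have [_ hB _] := hBBM; have [_ + _ _] := hB u; exact. Qed.

Lemma B0 u w : B u 0 w = 0.
Proof. by have [_ hB _] := hBBM; have [-> _ _ _] := hB u. Qed.

Lemma motion_before_measurable v beta : motion_before v beta `<=` measurable.
Proof. by move=> _ [a _ [Y mY <-]]; exact: measurable_funP. Qed.

Lemma measurable_incr v beta a : measurable_fun setT (increment (B v) beta a).
Proof. by apply: measurable_funB; exact: measurable_funP. Qed.

Lemma motion_after_measurable v beta : motion_after v beta `<=` measurable.
Proof. by move=> _ [a _ [Y mY <-]]; exact: measurable_incr. Qed.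

Lemma after_age_measurable v beta : after_age v beta `<=` measurable.
Proof.
move=> _ [F hF [G hG <-]]; apply: measurableI.
  exact: (g_sigma_measurable (@motion_after_measurable v beta) hF).
exact: (g_sigma_measurable (@clock_gen_measurable _) hG).
Qed.

Lemma motion_before_sub v beta : <<s motion_before v beta >> `<=` <<s clock_gen [set inr v] >>.
Proof.
apply: sigma_family_sub => a /= /andP[a0 _].
exact: measurable_B_gen.
Qed.

Lemma motion_after_sub v beta : 0 <= beta ->
  <<s motion_after v beta >> `<=` <<s clock_gen [set inr v] >>.
Proof.
move=> b0; apply: sigma_family_sub => a /= a0.
by apply: measurable_funB; apply: measurable_B_gen => //; rewrite addr_ge0.
Qed.

(** For [E] before, [F] after and [G] from the other clocks of the progeny, [G] splits off because
    its clocks differ from the motion of [v], and [E] and [F] separate by [indep_before_after]. *)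
Lemma indep_before_after_age v beta : 0 <= beta ->
  indep P <<s motion_before v beta >> <<s after_age v beta >>.
Proof.
move=> b0; have [_ hB _] := hBBM.
have inddesc : indep P <<s clock_gen [set inr v] >> <<s clock_gen (inside v `\ inr v) >>.
  by apply: indep_clock_gen; apply/seteqP; split=> // k [/= -> [_ []]].
have indBM : indep P <<s motion_before v beta >> <<s motion_after v beta >>.
  exact: (indep_before_after (hB v) b0).
have sbefore := @motion_before_sub v beta; have safter := @motion_after_sub v beta b0.
apply/indepC/indep_g_sigmal.
- move=> _ _ [F hF [G hG <-]] [F' hF' [G' hG' <-]]; rewrite setIACA.
  exists (F `&` F'); first exact: (@measurableI _ (sigmaT (motion_after v beta))).
  exists (G `&` G') => //.
  exact: (@measurableI _ (sigmaT (clock_gen (inside v `\ inr v)))).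
- exact: after_age_measurable.
- exact: (g_sigma_measurable (@motion_before_measurable v beta)).
apply: indepC => E _ hE [F hF [G hG <-]].
rewrite setIA inddesc//; last first.
  by apply: (@measurableI _ (sigmaT (clock_gen [set inr v]))); [exact: sbefore|exact: safter].
by rewrite indBM// [in RHS]inddesc ?muleA//; exact: safter.
Qed.

Lemma measurable_after_incr v beta a : 0 <= a ->
  measurable_fun setT (increment (B v) beta a : sigmaT (after_age v beta) -> R).
Proof.
move=> a0.
have sub : motion_after v beta `<=` <<s after_age v beta >>.
  move=> F hF; apply: sub_sigma_algebra; exists F; first exact: sub_sigma_algebra.
  exists setT; last by rewrite setIT.
  exact: (@measurableT _ (sigmaT (clock_gen (inside v `\ inr v)))).
apply: (measurable_sigmaT_sub sub).
exact: (@sigma_family_measurable _ _ _ _ [set a : R | 0 <= a] (increment (B v) beta)).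
Qed.

Lemma after_age_gen v beta (X : T -> R) :
  measurable_fun setT (X : sigmaT (clock_gen (inside v `\ inr v)) -> R) ->
  measurable_fun setT (X : sigmaT (after_age v beta) -> R).
Proof.
move=> mX; apply: measurable_sigmaT_sub mX => G hG.
apply: sub_sigma_algebra; exists setT.
  exact: (@measurableT _ (sigmaT (motion_after v beta))).
by exists G; [exact: sub_sigma_algebra|rewrite setTI].
Qed.

Section FreezeAtAge.
Variables (v : particle) (r : R).
Local Notation Tout := (sigmaT (clock_gen (outside v))).
Local Notation Tin := (sigmaT (clock_gen (inside v))).

Definition born w : Prop := 0 <= birth tau v w <= r.

(** Clamped to the interval from 0 to [r], so that it is a legitimate age at every sample point; on
    [born] it is the true age at time [r]. *)
Definition age w : R := Num.max 0 (Num.min r (r - birth tau v w)).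

(** The contribution of the strict ancestors to the position at time [a]; with nonnegative lifetimes
    it is the place of birth as soon as [v] is born by time [a]. *)
Definition birthplace (a : R) w : R :=
  \sum_(i < size v) B (take i v) (lived tau (take i v) a w) w.

(* The position of [v] at time [a], with its ancestors' clocks read off the first
   sample point and its own motion off the second one. *)
Definition split_position (a : R) (p : T * T) : R :=
  birthplace a p.1 + B v (Num.max 0 (a - birth tau v p.1)) p.2.

Lemma age_ge0 w : 0 <= age w.
Proof. by rewrite le_max lexx. Qed.

Lemma born_age w : born w -> age w = r - birth tau v w.
Proof.
move=> /andP[b0 br]; rewrite /age min_r; last by rewrite gerBl.
by rewrite max_r// subr_ge0.
Qed.

Lemma not_prefix_take i : (i < size v)%N -> ~~ prefix v (take i v).
Proof.
move=> iv; apply/negP => /size_prefix; rewrite (size_takel (ltnW iv)) => h.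
by have := leq_trans iv h; rewrite ltnn.
Qed.

Lemma measurable_birth_outside : measurable_fun setT (birth tau v : Tout -> R).
Proof.
apply: (@measurable_rbirth _ Tout R (fun u => tau u)) => i iv.
by apply: measurable_tau_gen; exact: not_prefix_take.
Qed.

Lemma measurable_age : measurable_fun setT (age : Tout -> R).
Proof.
apply: measurable_maxr => //; apply: measurable_minr => //.
by apply: measurable_funB => //; exact: measurable_birth_outside.
Qed.

Lemma measurable_birthplace a : measurable_fun setT (birthplace a : Tout -> R).
Proof.
apply: measurable_sum => -[i /= iv].
apply: (@measurable_eval_process _ Tout _ (B (take i v) : R -> T -> R)).
- by move=> c c0; apply: measurable_B_gen => //; exact: not_prefix_take.
- exact: continuous_B.
- apply: measurable_maxr => //; apply: measurable_minr.
    apply: measurable_funB => //.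
    apply: (@measurable_rbirth _ Tout R (fun u => tau u)) => j.
    rewrite size_takel ?(ltnW iv)// => ji; rewrite take_takel 1?ltnW//.
    apply: measurable_tau_gen; apply: not_prefix_take.
    exact: ltn_trans iv.
  by apply: measurable_tau_gen; exact: not_prefix_take.
- by move=> w; rewrite le_max lexx.
Qed.

Lemma measurable_split_position a :
  measurable_fun setT (split_position a : Tout * Tin -> R).
Proof.
apply: measurable_funD.
  exact: (measurableT_comp (measurable_birthplace a) measurable_fst).
apply: (@measurable_eval_process _ (Tout * Tin)%type _
  (fun c (p : Tout * Tin) => B v c p.2) (fun p => Num.max 0 (a - birth tau v p.1))).
- move=> c c0; apply: (measurableT_comp _ measurable_snd).
  by apply: measurable_B_gen => //=; exact: prefix_refl.
- by move=> p; exact: continuous_B.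
- apply: measurable_maxr => //; apply: measurable_funB => //.
  exact: (measurableT_comp measurable_birth_outside measurable_fst).
- by move=> p; rewrite le_max lexx.
Qed.

Lemma measurable_born : measurable ([set w | born w] : set Tout).
Proof.
have -> : [set w | born w] =
    [set w | 0 <= birth tau v w] `&` [set w | birth tau v w <= r].
  by apply/seteqP; split=> [w /andP//|w /= [h1 h2]]; rewrite /born h1.
have mb := measurable_birth_outside.
by apply: measurableI; exact: measurable_set_ler.
Qed.

(** With [w0] frozen the ancestors contribute a constant, and [a <= r] keeps the age at which [B v]
    is read below [age w0]. *)
Lemma measurable_split_position_before w0 a : born w0 -> a <= r ->
  measurable_fun setT ((fun w1 => split_position a (w0, w1)) :
    sigmaT (motion_before v (age w0)) -> R).
Proof.
move=> b0 ar; have c0 : 0 <= Num.max 0 (a - birth tau v w0) <= age w0.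
  rewrite le_max lexx/= born_age// ge_max lerD2r ar andbT subr_ge0.
  by case/andP: b0.
have mB : measurable_fun setT (B v (Num.max 0 (a - birth tau v w0)) :
    sigmaT (motion_before v (age w0)) -> R).
  exact: (@sigma_family_measurable _ _ _ _ [set a : R | 0 <= a <= age w0]
    (B v : R -> T -> R) _ c0).
exact: (measurable_funD (measurable_cst (birthplace a w0)) mB).
Qed.

(* A measurable description [K beta z] of what happens after [v] reaches age
   [beta] at position [z]. *)
Definition future_event (K : R -> R -> set T) : Prop :=
  measurable ([set p : (R * R) * Tin | K (Num.max 0 p.1.1) p.1.2 p.2]) /\
  forall beta, 0 <= beta ->
    measurable [set p : R * sigmaT (after_age v beta) | K beta p.1 p.2].

Definition split_event (K : R -> R -> set T) : set (T * T) :=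
  [set p | born p.1 /\ K (age p.1) (split_position r p) p.2].

Lemma measurable_split_event (K : R -> R -> set T) :
  measurable ([set p : (R * R) * Tin | K (Num.max 0 p.1.1) p.1.2 p.2]) ->
  measurable (split_event K : set (Tout * Tin)).
Proof.
move=> mK.
have -> : split_event K = (fst @^-1` [set w | born w]) `&`
    ((fun p : Tout * Tin => ((age p.1, split_position r p), p.2)) @^-1`
      [set p : (R * R) * Tin | K (Num.max 0 p.1.1) p.1.2 p.2]).
  by apply/seteqP; split=> p /=; rewrite (max_idPr (age_ge0 _)).
apply: measurableI; rewrite -[X in measurable X]setTI.
  by apply: measurable_fst => //; exact: measurable_born.
suff : measurable_fun setT (fun p : Tout * Tin => ((age p.1, split_position r p), p.2)).
  by apply.
apply/measurable_fun_pairP; split; last exact: measurable_snd.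
apply/measurable_fun_pairP; split; last exact: measurable_split_position.
exact: (measurableT_comp measurable_age measurable_fst).
Qed.

Local Open Scope ereal_scope.

(** Two decouplings in succession. The clocks outside and inside the progeny of [v] are independent,
    which yields [w0] and [w1]. With [w0] fixed the age is a constant, the motion of [v] before it
    is independent of [after_age], and the future is integrated out, leaving its probability at the
    current age and position. *)
Lemma integral_freeze (K : R -> R -> set T) (g : Tout * Tin -> \bar R) :
  future_event K -> measurable_fun setT g -> (forall p, 0 <= g p) ->
  (forall w0, born w0 ->
    measurable_fun setT ((fun w1 => g (w0, w1)) : sigmaT (motion_before v (age w0)) -> \bar R)) ->
  \int[P]_w (g (w, w) * (\1_(split_event K) (w, w))%:E) =
  \int[P]_w0 ((\1_[set w | born w] w0)%:E *
    \int[P]_w1 (g (w0, w1) * P (K (age w0) (split_position r (w0, w1))))).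
Proof.
move=> [mK mKb] mg g0 mgb.
have mKs := measurable_split_event mK.
rewrite (@indep_integral_diag _ _ _ P (clock_gen (outside v)) (clock_gen (inside v))
  (fun p => g p * (\1_(split_event K) p)%:E)); last 5 first.
- exact: clock_gen_measurable.
- exact: clock_gen_measurable.
- apply: indep_clock_gen; apply/seteqP; split=> // k [].
  by rewrite /outside /inside /= => /negP h /h.
- by apply: emeasurable_funM => //; apply/measurable_EFinP; exact: measurable_indic.
- by move=> p; rewrite mule_ge0// lee_fin.
apply: eq_integral => w0 _.
have [bw|nbw] := pselect (born w0); last first.
  rewrite [in RHS]indicE memNset// mul0e integral0_eq// => w1 _.
  by rewrite indicE memNset ?mule0// => -[].
rewrite [in RHS]indicE mem_set// mul1e.
have b0 := age_ge0 w0.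
(* The first coordinate carries the motion before the age, through [g] and the position; the second
   carries the future event. *)
pose f2 (p : sigmaT (motion_before v (age w0)) * sigmaT (after_age v (age w0))) :=
  g (w0, p.1) * (\1_[set p : T * T | K (age w0) (split_position r (w0, p.1)) p.2] p)%:E.
have mK2 : measurable ([set p : T * T | K (age w0) (split_position r (w0, p.1)) p.2] :
    set (sigmaT (motion_before v (age w0)) * sigmaT (after_age v (age w0)))).
  suff mf : measurable_fun setT (fun p : sigmaT (motion_before v (age w0)) *
      sigmaT (after_age v (age w0)) => (split_position r (w0, p.1), p.2)).
    by have := mf measurableT _ (mKb _ b0); rewrite setTI.
  apply/measurable_fun_pairP; split; last exact: measurable_snd.
  exact: (measurableT_comp (measurable_split_position_before bw (lexx r)) measurable_fst).
transitivity (\int[P]_w f2 (w, w)).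
  apply: eq_integral => w1 _; rewrite /f2 /=; congr (_ * _%:E).
  rewrite !indicE; congr (_%:R); congr (nat_of_bool _).
  by apply/idP/idP; rewrite !inE /split_event/=; [case|split].
rewrite (@indep_integral_diag _ _ _ P _ _ f2); last 5 first.
- exact: motion_before_measurable.
- exact: after_age_measurable.
- exact: indep_before_after_age.
- apply: emeasurable_funM; last by apply/measurable_EFinP; exact: measurable_indic.
  exact: (measurableT_comp (mgb _ bw) measurable_fst).
- by move=> p; rewrite mule_ge0// lee_fin.
apply: eq_integral => w1 _; rewrite /f2/=.
have mKw : measurable (K (age w0) (split_position r (w0, w1))).
  apply: (g_sigma_measurable (@after_age_measurable v (age w0))).
  have := @measurable_xsection _ _ _ (sigmaT (after_age v (age w0))) _
    (split_position r (w0, w1)) (mKb _ b0).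
  by rewrite xsectionE.
rewrite (eq_integral (fun w => g (w0, w1) *
  (\1_(K (age w0) (split_position r (w0, w1))) w)%:E)); last first.
  by move=> w _; congr (_ * _%:E); rewrite !indicE !in_setE.
rewrite ge0_integralZl//; last first.
  by apply/measurable_EFinP; exact: measurable_indic.
by rewrite integral_indic// setIT.
Qed.

End FreezeAtAge.
End BBMSigmaAlgebras.

(** * Law of the progeny of a particle of given age and position *)

Section ProductComposition.
Context {d1 d2 : measure_display} {M1 : measurableType d1} {M2 : measurableType d2}.
Context {R : realType}.

Lemma measurable_comp_fst (f : M1 -> R) : measurable_fun setT f ->
  measurable_fun setT (fun p : M1 * M2 => f p.1).
Proof. by move=> mf; exact: (measurableT_comp mf measurable_fst). Qed.

Lemma measurable_comp_snd (f : M2 -> R) : measurable_fun setT f ->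
  measurable_fun setT (fun p : M1 * M2 => f p.2).
Proof. by move=> mf; exact: (measurableT_comp mf measurable_snd). Qed.

End ProductComposition.

Section SubtreeLaw.
Context {d : measure_display} {T : measurableType d} {R : realType}.
Variable P : probability T R.
Variables (tau : particle -> {RV P >-> R}) (B : particle -> R -> {RV P >-> R}).
Hypothesis hBBM : is_BBM tau B.

(** Exponential lifetimes are nonnegative only almost surely, whereas the genealogical lemmas are
    pointwise. *)
Definition lifetimes_ge0 w : Prop := forall u, 0 <= tau u w.

Lemma ae_lifetimes_ge0 : {ae P, forall w, lifetimes_ge0 w}.
Proof.
have [hexp _ _] := hBBM.
have neg u : P [set w | tau u w < 0] = 0%E.
  have -> : [set w | tau u w < 0] = tau u @^-1` `]-oo, 0[%classic.
    by apply/seteqP; split=> w /=; rewrite in_itv.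
  rewrite hexp//; apply: integral0_eq => a /=; rewrite in_itv/= => a0.
  by rewrite lt0_exponential_pdf.
pose N (n : nat) := if unpickle n is Some u then [set w | tau u w < 0] else set0.
suff : P.-negligible (\bigcup_n N n).
  apply: negligibleS => w /= hw.
  move/existsNP : hw => [u /negP]; rewrite -ltNge => hu.
  by exists (pickle u) => //; rewrite /N pickleK.
apply: negligible_bigcup => n; rewrite /N; case: (unpickle n) => [u|].
  apply/negligibleP; last exact: neg.
  by apply: measurable_set_ltr => //; exact: measurable_funP.
exact: negligible_set0.
Qed.

Definition subtree_reaches v (dt lv beta z : R) w : Prop :=
  reaches (shift_life v beta (fun u => tau u w))
    (shift_disp v beta (fun u a => B u a w)) dt (lv - z).

(** [pi] extracts the sample point from [M], which may be a product of a parameter space with [T]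
    under a sub-sigma-algebra. *)
Lemma measurable_subtree_reaches (d' : measure_display) (M : measurableType d') (pi : M -> T)
    v (dt lv : R) (beta z : M -> R) :
  (forall q, measurable_fun setT (fun m => tau (v ++ q) (pi m))) ->
  (forall q a, ~~ nilp q -> 0 <= a -> measurable_fun setT (fun m => B (v ++ q) a (pi m))) ->
  (forall a, 0 <= a -> measurable_fun setT (fun m => increment (B v) (beta m) a (pi m))) ->
  measurable_fun setT beta -> (forall m, 0 <= beta m) -> measurable_fun setT z ->
  measurable [set m | subtree_reaches v dt lv (beta m) (z m) (pi m)].
Proof.
move=> mt mB mI mb b0 mz.
apply: (@measurable_reaches_shift _ M R (fun u m => tau u (pi m))
  (fun u a m => B u a (pi m)) v dt beta (fun m => lv - z m)).
- exact: mt.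
- exact: mB.
- exact: mI.
- by move=> q m; exact: (@continuous_B _ _ _ _ _ _ hBBM (v ++ q) (pi m)).
- exact: mb.
- exact: b0.
- exact: measurable_funB.
Qed.

Let tau_inside v q :
  measurable_fun setT (tau (v ++ q) : sigmaT (clock_gen tau B (inside v)) -> R).
Proof. by apply: measurable_tau_gen; rewrite /inside/= prefix_prefix. Qed.

Let B_inside v q a : 0 <= a ->
  measurable_fun setT (B (v ++ q) a : sigmaT (clock_gen tau B (inside v)) -> R).
Proof. move=> a0; apply: measurable_B_gen => //; by rewrite /inside/= prefix_prefix. Qed.

Let tau_after v q beta :
  measurable_fun setT (tau (v ++ q) : sigmaT (after_age tau B v beta) -> R).
Proof.
apply: after_age_gen; apply: measurable_tau_gen; split=> //; by rewrite /inside/= prefix_prefix.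
Qed.

Let B_after v q a beta : ~~ nilp q -> 0 <= a ->
  measurable_fun setT (B (v ++ q) a : sigmaT (after_age tau B v beta) -> R).
Proof.
move=> q0 a0; apply: after_age_gen; apply: measurable_B_gen => //.
split=> /=; first by rewrite /inside/= prefix_prefix.
move=> [] /(congr1 size); rewrite size_cat => /eqP.
by rewrite -{2}[size v]addn0 eqn_add2l => h; rewrite /nilp h in q0.
Qed.

Lemma measurable_subtree_inside v (dt lv : R) :
  measurable ([set p | subtree_reaches v dt lv (Num.max 0 p.1.1) p.1.2 p.2] :
    set ((R * R) * sigmaT (clock_gen tau B (inside v)))).
Proof.
pose C := clock_gen tau B (inside v).
pose M : measurableType _ := ((R * R) * sigmaT C)%type.
have mb : measurable_fun setT (fun p : M => Num.max 0 p.1.1).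
  apply: measurable_maxr => //.
  exact: (measurableT_comp measurable_fst measurable_fst).
have b0 (p : M) : 0 <= Num.max 0 p.1.1 by rewrite le_max lexx.
apply: (@measurable_subtree_reaches _ M (fun p => p.2) v dt lv (fun p => Num.max 0 p.1.1)
  (fun p => p.1.2)).
- move=> q; exact: (@measurable_comp_snd _ _ (R * R)%type (sigmaT C) _ _ (@tau_inside v q)).
- move=> q a q0 a0; exact: (@measurable_comp_snd _ _ (R * R)%type (sigmaT C) _ _
  (@B_inside v q a a0)).
- move=> a a0; apply: (@measurable_increment _ M _ (fun a p => B v a p.2)) => //.
  + move=> c c0; have := @B_inside v [::] c c0; rewrite cats0 => h.
    exact: (@measurable_comp_snd _ _ (R * R)%type (sigmaT C) _ _ h).
  + by move=> p; exact: (@continuous_B _ _ _ _ _ _ hBBM v p.2).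
- exact: mb.
- exact: b0.
- exact: (measurableT_comp measurable_snd measurable_fst).
Qed.

Lemma measurable_subtree_after v (dt lv beta : R) : 0 <= beta ->
  measurable ([set p | subtree_reaches v dt lv beta p.1 p.2] :
    set (R * sigmaT (after_age tau B v beta))).
Proof.
move=> b0; pose C := after_age tau B v beta.
pose M : measurableType _ := (R * sigmaT C)%type.
apply: (@measurable_subtree_reaches _ M (fun p => p.2) v dt lv (fun=> beta) (fun p => p.1)) => //.
- move=> q; exact: (@measurable_comp_snd _ _ _ (sigmaT C) _ _ (@tau_after v q beta)).
- move=> q a q0 a0.
  exact: (@measurable_comp_snd _ _ _ (sigmaT C) _ _ (@B_after v q a beta q0 a0)).
- move=> a a0.
  exact: (@measurable_comp_snd _ _ _ (sigmaT C) _ _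
    (@measurable_after_incr _ _ _ _ tau B v beta a a0)).
- exact: measurable_fst.
Qed.

Section TwoTimes.
Variables (r s t x y : R).

(** [psi] is a Boolean function of the two outcomes, so that single misses, joint misses and joint
    hits are treated at once; the constant [true] leaves only survival to age [beta]. *)
Definition pair_event (psi : bool -> bool -> bool) v (beta z : R) : set T :=
  [set w | beta < tau v w /\
     psi `[< subtree_reaches v (s - r) x beta z w >]
         `[< subtree_reaches v (t - r) y beta z w >]].

Let measurable_psi (d' : measure_display) (M : measurableType d')
   (psi : bool -> bool -> bool) (A1 A2 : set M) : measurable A1 -> measurable A2 ->
  measurable [set m | psi `[< A1 m >] `[< A2 m >]].
Proof.
move=> m1 m2; apply: measurable_set_bool.
have mA A : measurable A -> measurable_fun setT (fun m : M => `[< A m >]).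
  move=> mA; apply: measurable_bool_set; congr (measurable _) : mA.
  by apply/seteqP; split=> m /asboolP.
have -> : (fun m => psi `[< A1 m >] `[< A2 m >]) = (fun m =>
    if `[< A1 m >] then (if `[< A2 m >] then psi true true else psi true false)
    else (if `[< A2 m >] then psi false true else psi false false)).
  by apply/funext => m; case: `[< A1 m >]; case: `[< A2 m >].
by apply: measurable_fun_ifT; [exact: mA|apply: measurable_fun_ifT => //; exact: mA..].
Qed.

Lemma future_pair_event psi v : future_event tau B v (pair_event psi v).
Proof.
split=> [|beta b0].
  have -> : [set p : R * R * T | pair_event psi v (Num.max (0 : R) p.1.1) p.1.2 p.2] =
      [set p : R * R * T | Num.max 0 p.1.1 < tau v p.2] `&`
      [set p : R * R * T | psi
        `[< [set p | subtree_reaches v (s - r) x (Num.max 0 p.1.1) p.1.2 p.2] p >]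
        `[< [set p | subtree_reaches v (t - r) y (Num.max 0 p.1.1) p.1.2 p.2] p >]].
    by [].
  apply: measurableI; last by apply: measurable_psi; exact: measurable_subtree_inside.
  apply: measurable_set_ltr.
    apply: measurable_maxr => //.
    exact: (measurableT_comp measurable_fst measurable_fst).
  have := @tau_inside v [::]; rewrite cats0 => h.
  exact: (@measurable_comp_snd _ _ (R * R)%type (sigmaT (clock_gen tau B (inside v))) _ _ h).
have -> : [set p : R * T | pair_event psi v beta p.1 p.2] =
    [set p : R * T | beta < tau v p.2] `&`
    [set p : R * T | psi
        `[< [set p | subtree_reaches v (s - r) x beta p.1 p.2] p >]
        `[< [set p | subtree_reaches v (t - r) y beta p.1 p.2] p >]].
  by [].
apply: measurableI; last by apply: measurable_psi; exact: measurable_subtree_after.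
apply: measurable_set_ltr => //.
have := @tau_after v [::] beta; rewrite cats0 => h.
exact: (@measurable_comp_snd _ _ _ (sigmaT (after_age tau B v beta)) _ _ h).
Qed.

Lemma measurable_pair_event psi v beta z : 0 <= beta ->
  measurable (pair_event psi v beta z).
Proof.
move=> b0; have [_ /(_ beta b0) mK] := future_pair_event psi v.
apply: (g_sigma_measurable (@after_age_measurable _ _ _ _ tau B v beta)).
have := @measurable_xsection _ _ _ (sigmaT (after_age tau B v beta)) _ z mK.
by rewrite xsectionE.
Qed.

(* Conditional probability, given that [v] is at [z] at age [beta] and lives on,
   that [psi] holds for the events "the progeny of [v] reaches [x] at [s]" and
   "... [y] at [t]"; if [v] almost surely does not live on, the law of the pair is
   set to be the point mass at (false, false). *)
Definition pair_law (psi : bool -> bool -> bool) v (beta z : R) : R :=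
  let q := fine (P [set w | beta < tau v w]) in
  if q == 0 then (psi false false)%:R else fine (P (pair_event psi v beta z)) / q.

Let mlive v (beta : R) : measurable [set w | beta < tau v w].
Proof. by apply: measurable_set_ltr => //; exact: measurable_funP. Qed.

(** The product form of conditioning on survival; when survival has probability 0 both sides
    vanish. *)
Lemma pair_law_mul psi v beta z : 0 <= beta ->
  (P (pair_event psi v beta z) =
   (pair_law psi v beta z)%:E * P (pair_event (fun _ _ => true) v beta z))%E.
Proof.
move=> b0; have mK := measurable_pair_event psi v z b0.
have -> : pair_event (fun _ _ => true) v beta z = [set w | beta < tau v w].
  by apply/seteqP; split=> [w []//|w ?]; split.
have sub : (P (pair_event psi v beta z) <= P [set w | (beta < tau v w)%R])%E.
  by apply: le_measure; rewrite ?inE//; move=> w [].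
have f1 := fin_num_measure P _ mK; have f2 := fin_num_measure P _ (mlive v beta).
rewrite /pair_law; case: eqP => [q0|/eqP q0].
  have z0 : P [set w | (beta < tau v w)%R] = 0%E by rewrite -(fineK f2) q0.
  rewrite z0 mule0; apply/eqP; rewrite eq_le measure_ge0 andbT.
  by rewrite -z0.
by rewrite -{2}(fineK f2) -EFinM divfK// fineK.
Qed.

Lemma pair_law_ge0 psi v beta z : 0 <= pair_law psi v beta z.
Proof.
by rewrite /pair_law; case: eqP => // _; rewrite divr_ge0// fine_ge0.
Qed.

Lemma pair_law_true v beta z : pair_law (fun _ _ => true) v beta z = 1.
Proof.
rewrite /pair_law; case: eqP => // /eqP q0.
have -> : pair_event (fun _ _ => true) v beta z = [set w | beta < tau v w].
  by apply/seteqP; split=> [w []//|w ?]; split.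
by rewrite divff.
Qed.

(** The degenerate case is covered because [pair_law] is then a point mass. Thus for every age
    [pair_law] behaves as a probability on the four outcomes. *)
Lemma pair_lawD psi phi v beta z : 0 <= beta ->
  (forall i j, ~~ (psi i j && phi i j)) ->
  pair_law (fun i j => psi i j || phi i j) v beta z =
  pair_law psi v beta z + pair_law phi v beta z.
Proof.
move=> b0 dis; rewrite /pair_law; case: eqP => _.
  by have := dis false false; case: (psi _ _); case: (phi _ _) => //= _; rewrite ?addr0 ?add0r.
have -> : pair_event (fun i j => psi i j || phi i j) v beta z =
    pair_event psi v beta z `|` pair_event phi v beta z.
  apply/seteqP; split=> w.
    by move=> [bw /orP[]]; [left|right].
  by move=> [[bw h]|[bw h]]; split=> //; rewrite h ?orbT.
have mK1 := measurable_pair_event psi v z b0.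
have mK2 := measurable_pair_event phi v z b0.
rewrite measureU//; last first.
  apply/seteqP; split=> // w [[_ h1] [_ h2]].
  by have := dis `[< subtree_reaches v (s - r) x beta z w >]
    `[< subtree_reaches v (t - r) y beta z w >]; rewrite h1 h2.
by rewrite fineD ?fin_num_measure// mulrDl.
Qed.

Lemma measurable_pair_law psi v :
  measurable_fun setT (fun p : R * R => pair_law psi v (Num.max 0 p.1) p.2).
Proof.
have [mK _] := future_pair_event psi v.
have [mK1 _] := future_pair_event (fun _ _ => true) v.
pose Tin := sigmaT (clock_gen tau B (inside v)).
pose i1 : {mfun T >-> Tin} := HB.pack (id : T -> Tin)
  (isMeasurableFun.Build _ _ _ _ _ (measurable_id_sub
    (@clock_gen_measurable _ _ _ _ tau B (inside v)))).
pose P1 : probability Tin R := distribution P i1.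
have mP K : measurable ([set p : (R * R) * Tin | K (Num.max 0 p.1.1) p.1.2 p.2]) ->
    measurable_fun setT (fun p : R * R => fine (P (K (Num.max 0 p.1) p.2))).
  move=> mA; apply: measurableT_comp; first exact: fine_measurable.
  have := @measurable_fun_xsection _ _ _ Tin _ P1 _ mA.
  congr (measurable_fun _ _); apply/funext => p /=.
  by rewrite xsectionE.
have mq : measurable_fun setT (fun p : R * R =>
    fine (P [set w | Num.max 0 p.1 < tau v w])).
  have := mP _ mK1; congr (measurable_fun _ _); apply/funext => p.
  by congr (fine (P _)); apply/seteqP; split=> [w []//|w ?]; split.
apply: measurable_fun_ifT => //.
  exact: measurable_fun_eqr.
apply: measurable_funM; first exact: mP.
(* On nonnegative arguments, 0 included, the power of exponent -1 coincides with the inverse, and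
   [measurable_powR] applies. *)
have -> : (fun p : R * R => (fine (P [set w | Num.max 0 p.1 < tau v w]))^-1) =
    (fun p : R * R => fine (P [set w | Num.max 0 p.1 < tau v w]) `^ (-1)).
  by apply/funext => p; rewrite powR_inv1// fine_ge0.
exact: (measurableT_comp (measurable_powR _) mq).
Qed.

End TwoTimes.
End SubtreeLaw.

(** * The past as seen from a particle alive at time [r] *)

Section ConditionalIndependence.
Context {d : measure_display} {T : measurableType d} {R : realType}.
Variable P : probability T R.
Variables (tau : particle -> {RV P >-> R}) (B : particle -> R -> {RV P >-> R}).
Hypothesis hBBM : is_BBM tau B.
Variable r : R.
Hypothesis r0 : 0 <= r.

Local Notation Tout v := (sigmaT (clock_gen tau B (outside v))).
Local Notation Tin v := (sigmaT (clock_gen tau B (inside v))).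

Definition filtration_gen : set (set T) :=
  [set E | exists s u (A : set R), [/\ 0 <= s <= r, measurable A &
     E = [set w | alive tau s w u /\ A (position tau B u s w)]]].

Section AliveParticle.
Variables (v : particle) (w : T).
Hypotheses (gw : lifetimes_ge0 tau w) (av : alive tau r w v).

Lemma alive_born : born tau v r w.
Proof.
have /andP[h _] := av; rewrite /born h andbT.
exact: (@rbirth_ge0 R (fun u => tau u w)).
Qed.

Lemma alive_age : age tau v r w = r - birth tau v w.
Proof. exact/born_age/alive_born. Qed.

Lemma alive_age_lt : age tau v r w < tau v w.
Proof. by have /andP[_ h] := av; rewrite alive_age ltrBlDl. Qed.

Lemma alive_position a : a <= r ->
  position tau B v a w = split_position tau B v a (w, w).
Proof.
move=> ar; rewrite /position big_ord_recr/= /split_position/= take_size; congr (_ + B v _ w).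
rewrite /lived min_l// lerBlDl; have /andP[_ h] := av.
exact: (le_trans ar (ltW h)).
Qed.

End AliveParticle.

Lemma born_alive v w : born tau v r w -> age tau v r w < tau v w -> alive tau r w v.
Proof.
move=> bw; rewrite (born_age bw) /alive/= /death => h.
by have /andP[_ ->] := bw; rewrite /= -ltrBlDl.
Qed.

Local Open Scope ereal_scope.

(** The factors allowed beside the future of [v] in [integral_freeze]: when [v] is alive at time
    [r], [g] agrees with a function of a doubled sample point which, once the clocks outside the
    progeny are frozen, reads only the motion of [v] before its age. *)
Definition adapted v (g : T -> \bar R) : Prop :=
  exists g' : Tout v * Tin v -> \bar R,
  [/\ measurable_fun setT g', (forall p, 0 <= g' p),
      (forall w0, born tau v r w0 -> measurable_fun setT
        ((fun w1 => g' (w0, w1)) : sigmaT (motion_before B v (age tau v r w0)) -> \bar R)) &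
      forall w, lifetimes_ge0 tau w -> alive tau r w v -> g w = g' (w, w)].

Lemma adapted_outside v (g : T -> \bar R) :
  measurable_fun setT (g : Tout v -> \bar R) -> (forall w, 0 <= g w) -> adapted v g.
Proof.
move=> mg g0; exists (fun p => g p.1); split => //.
- exact: (measurableT_comp mg measurable_fst).
- by move=> w0 _; exact: (@measurable_cst _ _ _ _ _ (g w0)).
Qed.

Lemma adapted_eq v (g h : T -> \bar R) :
  (forall w, lifetimes_ge0 tau w -> alive tau r w v -> g w = h w) ->
  adapted v g -> adapted v h.
Proof.
move=> gh [g' [m1 m2 m3 m4]]; exists g'; split => // w gw aw.
by rewrite -gh// m4.
Qed.

Lemma adaptedM v (g h : T -> \bar R) :
  adapted v g -> adapted v h -> adapted v (fun w => g w * h w).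
Proof.
move=> [g' [m1 m2 m3 m4]] [h' [n1 n2 n3 n4]].
exists (fun p => g' p * h' p); split.
- exact: emeasurable_funM.
- by move=> p; rewrite mule_ge0.
- by move=> w0 bw; apply: emeasurable_funM; [exact: m3|exact: n3].
- by move=> w gw aw; rewrite m4// n4.
Qed.

Lemma adapted_prod v (V : seq particle) (f : particle -> T -> R) :
  (forall u, u \in V -> adapted v (fun w => (f u w)%:E)) ->
  adapted v (fun w => (\prod_(u <- V) f u w)%:E).
Proof.
elim: V => [_|u V IH h].
  apply: adapted_outside => [|w]; last by rewrite big_nil lee_fin.
  rewrite [X in measurable_fun _ X](_ : _ = cst 1); first exact: measurable_cst.
  by apply/funext => w; rewrite big_nil.
apply: (@adapted_eq _ (fun w => (f u w)%:E * (\prod_(u <- V) f u w)%:E)).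
  by move=> w _ _; rewrite big_cons EFinM.
apply: adaptedM; first by apply: h; rewrite inE eqxx.
by apply: IH => z zV; apply: h; rewrite inE zV orbT.
Qed.

(* Membership in the sigma-algebra of the past is decided, on [v] alive at time
   [r], by the clocks outside the progeny of [v] and the motion of [v] before its
   age at time [r]. *)
Definition adapted_set v (C : set T) : Prop :=
  exists C' : set (T * T), [/\ measurable (C' : set (Tout v * Tin v)),
    forall w0, born tau v r w0 ->
      <<s motion_before B v (age tau v r w0) >> [set w1 | C' (w0, w1)] &
    forall w, lifetimes_ge0 tau w -> alive tau r w v -> C w <-> C' (w, w)].

Lemma adapted_set_sigma v : sigma_algebra setT (adapted_set v).
Proof.
split.
- exists set0; split => // w0 _.
  exact: (@measurable0 _ (sigmaT (motion_before B v (age tau v r w0)))).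
- move=> A [C' [m1 m2 m3]]; exists (~` C'); split.
  + exact: measurableC.
  + move=> w0 bw.
    exact: (@measurableC _ (sigmaT (motion_before B v (age tau v r w0))) _ (m2 _ bw)).
  + move=> w gw aw; rewrite setTD /=; have := m3 w gw aw; tauto.
- move=> F /choice[F' hF']; exists (\bigcup_n F' n); split.
  + by apply: bigcupT_measurable => n; case: (hF' n).
  + move=> w0 bw.
    have -> : [set w1 | (\bigcup_n F' n) (w0, w1)] = \bigcup_n [set w1 | F' n (w0, w1)].
      by [].
    apply: (@bigcupT_measurable _ (sigmaT (motion_before B v (age tau v r w0)))) => n.
    by case: (hF' n) => _ + _; apply.
  + move=> w gw aw; split=> -[n _ h]; exists n => //;
      by case: (hF' n) => _ _ /(_ w gw aw) h'; apply/h'.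
Qed.

(** It suffices to treat the generating events, which concern a label [u] at a time [a <= r]. If [u]
    is not in the progeny of [v], only clocks outside it are involved. *)
Lemma adapted_set_filtration v : filtration tau B r `<=` adapted_set v.
Proof.
apply: smallest_sub; first exact: adapted_set_sigma.
move=> _ [a [u [A [/andP[a0 ar] mA ->]]]].
have [vu|nvu] := boolP (prefix v u); last first.
  have pre i : ~~ prefix v (take i u).
    by apply: contra nvu => h; apply: (prefix_trans h); exact: prefix_take.
  pose E := [set w | alive tau a w u /\ A (position tau B u a w)].
  have mE : measurable (E : set (Tout v)).
    have -> : E = [set w | ralive (fun u => tau u w) a u] `&`
       (position tau B u a @^-1` A) by [].
    apply: measurableI.
      apply: (@measurable_ralive _ (Tout v) R (fun u => tau u)) => i _.
      by apply: measurable_tau_gen; exact: pre.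
    rewrite -[X in measurable X]setTI.
    apply: (@measurable_rposition _ (Tout v) R (fun u => tau u) (fun u => B u) u a) => //.
    + by move=> i _; apply: measurable_tau_gen; exact: pre.
    + by move=> i c _ c0; apply: measurable_B_gen => //; exact: pre.
    + by move=> i _; exact: (@continuous_B _ _ _ _ _ _ hBBM).
  exists (fst @^-1` E); split => //.
    by rewrite -[X in measurable X]setTI; exact: measurable_fst.
  move=> w0 _; have [Ew|nEw] := pselect (E w0).
    rewrite (_ : [set _ | _] = setT); last by apply/seteqP; split.
    exact: (@measurableT _ (sigmaT (motion_before B v (age tau v r w0)))).
  rewrite (_ : [set _ | _] = set0); last by apply/seteqP; split.
  exact: (@measurable0 _ (sigmaT (motion_before B v (age tau v r w0)))).
(* A strict descendant of [v] is born no earlier than the death of [v], hence after [r]: while [v]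
   is alive the event is empty. *)
have [uv|uv] := eqVneq u v; last first.
  exists set0; split => //.
    move=> w0 _; exact: (@measurable0 _ (sigmaT (motion_before B v (age tau v r w0)))).
  move=> w gw aw; split=> // -[au _].
  have /prefixP[q uE] := vu.
  have q0 : ~~ nilp q by apply: contra uv => /nilP q0; rewrite uE q0 cats0.
  have /andP[h1 _] := au; have /andP[_ h2] := aw.
  have := @rbirth_cat R (fun u => tau u w) v q q0; rewrite -uE => hb.
  have : (birth tau v w + tau v w <= birth tau u w)%R.
    by rewrite /birth [leRHS]hb lerDl sumr_ge0.
  move=> /(lt_le_trans h2) h3.
  by have := lt_le_trans h3 (le_trans h1 ar); rewrite ltxx.
rewrite uv {u vu uv}.
(* For [v] alive at time [r], being alive at [a] amounts to being born by [a], so the lifetime of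
   [v] is not read. *)
exists [set p | (birth tau v p.1 <= a)%R /\ A (split_position tau B v a p)].
have mb := @measurable_birth_outside _ _ _ _ tau B v.
split.
- apply: measurableI.
    apply: measurable_set_ler => //.
    exact: (measurableT_comp mb measurable_fst).
  rewrite -[X in measurable X]setTI.
  exact: (@measurable_split_position _ _ _ _ _ _ hBBM v a).
- move=> w0 bw.
  have mS := @measurable_split_position_before _ _ _ _ tau B v r w0 a bw ar.
  have [ba|nba] := boolP (birth tau v w0 <= a)%R.
    rewrite (_ : [set _ | _] = (fun w1 => split_position tau B v a (w0, w1)) @^-1` A);
      last by apply/seteqP; split=> w1 //= [].
    by have := mS measurableT _ mA; rewrite setTI.
  rewrite (_ : [set _ | _] = set0); last by apply/seteqP; split=> w1 //= [ba]; rewrite ba in nba.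
  exact: (@measurable0 _ (sigmaT (motion_before B v (age tau v r w0)))).
- move=> w gw aw; rewrite /= (alive_position aw ar).
  have /andP[_ h2] := aw.
  split=> -[h hA]; split=> //; first by case/andP: h.
  by rewrite /alive/= h (le_lt_trans ar h2).
Qed.

Lemma adapted_filtration v (C : set T) : filtration tau B r C ->
  adapted v (fun w => (\1_C w)%:E).
Proof.
move=> /(@adapted_set_filtration v)[C' [m1 m2 m3]].
exists (fun p => (\1_C' p)%:E); split.
- by apply/measurable_EFinP; exact: measurable_indic.
- by move=> p; rewrite lee_fin.
- move=> w0 bw; apply/measurable_EFinP.
  have -> : (fun w1 => \1_C' (w0, w1)) = \1_[set w1 | C' (w0, w1)] :> (T -> R).
    by apply/funext => w1; rewrite !indicE; congr (nat_of_bool _)%:R; apply/idP/idP; rewrite !inE.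
  exact: (@measurable_indic _ (sigmaT (motion_before B v (age tau v r w0))) R setT _
    (m2 w0 bw)).
- move=> w gw aw; rewrite !indicE; congr (_%:R%:E); congr (nat_of_bool _).
  by apply/idP/idP; rewrite !inE => /(m3 w gw aw).
Qed.

End ConditionalIndependence.

(** * Conditional law of one progeny given the past *)

Section ConditionalLaw.
Context {d : measure_display} {T : measurableType d} {R : realType}.
Variable P : probability T R.
Variables (tau : particle -> {RV P >-> R}) (B : particle -> R -> {RV P >-> R}).
Hypothesis hBBM : is_BBM tau B.
Variables (r s t x y : R).
Hypothesis r0 : 0 <= r.

Definition progeny_reaches v (dt lv : R) w : Prop :=
  alive tau r w v /\
  subtree_reaches tau B v dt lv (age tau v r w) (position tau B v r w) w.

Definition progeny_event (psi : bool -> bool -> bool) v w : bool :=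
  psi `[< progeny_reaches v (s - r) x w >] `[< progeny_reaches v (t - r) y w >].

(** A label not alive at time [r] reaches nothing, so its law is the point mass at (false, false).
    This makes [progeny_event] and [progeny_law] comparable for every label of a fixed list. *)
Definition progeny_law (psi : bool -> bool -> bool) v w : R :=
  if `[< alive tau r w v >]
  then pair_law tau B r s t x y psi v (Num.max 0 (age tau v r w)) (position tau B v r w)
  else (psi false false)%:R.

Lemma progeny_law_ge0 psi v w : 0 <= progeny_law psi v w.
Proof. by rewrite /progeny_law; case: ifP => // _; exact: pair_law_ge0. Qed.

Section ClockMeasurability.
Variables (J : set (particle + particle)) (v : particle).
Hypothesis hJ : forall k, prefix v (clock_label k) || prefix (clock_label k) v -> J k.
Local Notation TJ := (sigmaT (clock_gen tau B J)).

Let tau_take i : measurable_fun setT (tau (take i v) : TJ -> R).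
Proof. by apply: measurable_tau_gen; apply: hJ; rewrite /= prefix_take orbT. Qed.

Let tau_cat q : measurable_fun setT (tau (v ++ q) : TJ -> R).
Proof. by apply: measurable_tau_gen; apply: hJ; rewrite /= prefix_prefix. Qed.

Let B_take i a : 0 <= a -> measurable_fun setT (B (take i v) a : TJ -> R).
Proof. by move=> a0; apply: measurable_B_gen => //; apply: hJ; rewrite /= prefix_take orbT. Qed.

Let B_cat q a : 0 <= a -> measurable_fun setT (B (v ++ q) a : TJ -> R).
Proof. by move=> a0; apply: measurable_B_gen => //; apply: hJ; rewrite /= prefix_prefix. Qed.

Lemma measurable_alive_clock : measurable ([set w | alive tau r w v] : set TJ).
Proof.
apply: (@measurable_ralive _ TJ R (fun u => tau u)) => i _; exact: tau_take.
Qed.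

Lemma measurable_age_clock : measurable_fun setT (age tau v r : TJ -> R).
Proof.
apply: measurable_maxr => //; apply: measurable_minr => //.
apply: measurable_funB => //.
apply: (@measurable_rbirth _ TJ R (fun u => tau u)) => i _; exact: tau_take.
Qed.

Lemma measurable_position_clock : measurable_fun setT (position tau B v r : TJ -> R).
Proof.
apply: (@measurable_rposition _ TJ R (fun u => tau u) (fun u => B u) v r).
- by move=> i _; exact: tau_take.
- by move=> i c _ c0; exact: B_take.
- by move=> i _; exact: (@continuous_B _ _ _ _ _ _ hBBM).
Qed.

(** Only clocks of ancestors and descendants of [v] are involved. [J = setT] gives plain
    measurability; [J] the clocks outside an incomparable label makes this event harmless for that
    label. *)
Lemma measurable_progeny_reaches dt lv :
  measurable ([set w | progeny_reaches v dt lv w] : set TJ).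
Proof.
have -> : [set w | progeny_reaches v dt lv w] = [set w | alive tau r w v] `&`
    [set w | subtree_reaches tau B v dt lv (age tau v r w) (position tau B v r w) w].
  by apply/seteqP; split.
apply: measurableI; first exact: measurable_alive_clock.
apply: (@measurable_subtree_reaches _ _ _ _ _ _ hBBM _ TJ id).
- exact: tau_cat.
- by move=> q a _; exact: B_cat.
- move=> a a0; apply: (@measurable_increment _ TJ R (B v)) => //.
  + by move=> c c0; have := @B_cat [::] c c0; rewrite cats0.
  + exact: (@continuous_B _ _ _ _ _ _ hBBM).
  + exact: measurable_age_clock.
  + by move=> w; exact: age_ge0.
- exact: measurable_age_clock.
- by move=> w; exact: age_ge0.
- exact: measurable_position_clock.
Qed.

Lemma measurable_progeny_event psi :
  measurable_fun setT ((fun w => (progeny_event psi v w)%:R) : TJ -> R).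
Proof.
have mb dt lv : measurable_fun setT ((fun w => `[< progeny_reaches v dt lv w >]) : TJ -> bool).
  apply: measurable_bool_set; have := measurable_progeny_reaches dt lv.
  by congr measurable; apply/seteqP; split=> w /asboolP.
have -> : (fun w => (progeny_event psi v w)%:R) = (fun w =>
    if `[< progeny_reaches v (s - r) x w >]
    then if `[< progeny_reaches v (t - r) y w >] then (psi true true)%:R else (psi true false)%:R
    else if `[< progeny_reaches v (t - r) y w >] then (psi false true)%:R
         else (psi false false)%:R) :> (T -> R).
  by apply/funext => w; rewrite /progeny_event; case: `[< _ >]; case: `[< _ >].
by apply: measurable_fun_ifT => //; apply: measurable_fun_ifT.
Qed.

Lemma measurable_progeny_law psi : measurable_fun setT (progeny_law psi v : TJ -> R).
Proof.
apply: measurable_fun_ifT => //.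
  apply: measurable_bool_set; have := measurable_alive_clock.
  by congr measurable; apply/seteqP; split=> w /asboolP.
exact: (measurableT_comp (@measurable_pair_law _ _ _ _ _ _ hBBM r s t x y psi v)
  (measurable_fun_pair measurable_age_clock measurable_position_clock)).
Qed.

End ClockMeasurability.

Lemma measurable_clockT (X : T -> R) :
  measurable_fun setT (X : sigmaT (clock_gen tau B setT) -> R) -> measurable_fun setT X.
Proof.
move=> mX _ Y mY; rewrite setTI.
apply: (g_sigma_measurable (@clock_gen_measurable _ _ _ _ tau B setT)).
exact: (sigmaT_measurable mX).
Qed.

Lemma measurable_alive v : measurable [set w | alive tau r w v].
Proof.
apply: (g_sigma_measurable (@clock_gen_measurable _ _ _ _ tau B setT)).
exact: (@measurable_alive_clock setT v (fun _ _ => I)).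
Qed.

(** The law is a function of age and position at time [r]. The position is read directly from the
    generators of the past; the age is recovered from the earlier times at which [v] was already
    alive. *)
Lemma measurable_progeny_law_filtration psi v :
  measurable_fun setT (progeny_law psi v : sigmaT (filtration_gen tau B r) -> R).
Proof.
pose F := filtration_gen tau B r; pose TF := sigmaT F.
have hN a : 0 <= a <= r -> measurable ([set w | alive tau a w v] : set TF).
  move=> ar; apply: sub_sigma_algebra; exists a, v, setT; split => //.
  by apply/seteqP; split=> [w|w []].
have mN : measurable ([set w | alive tau r w v] : set TF) by apply: hN; rewrite r0 lexx.
have mp : measurable_fun ([set w | alive tau r w v] : set TF) (position tau B v r).
  move=> _ Y mY; apply: sub_sigma_algebra; exists r, v, Y.
  by split => //; rewrite r0 lexx.
have ma : measurable_fun ([set w | alive tau r w v] : set TF) (age tau v r).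
  apply: (measurability (@RGenCInfty.G R)) => [|/= _ [_ [c ->] <-]].
    exact: RGenCInfty.measurableE.
  have [c0|c0] := leP c 0.
    rewrite (_ : _ `&` _ = [set w | alive tau r w v])//.
    apply/seteqP; split=> [w []//|w aw]; split=> //=; rewrite in_itv/= andbT.
    exact: (le_trans c0 (age_ge0 _ _ _ _)).
  have [cr|cr] := leP c r; last first.
    rewrite (_ : _ `&` _ = set0); first exact: measurable0.
    apply/seteqP; split=> // w /= [_]; rewrite in_itv/= andbT leNgt => /negP; apply.
    by rewrite /age gt_max c0 gt_min cr.
  (* A particle alive at time [r] has age at least [c] if and only if it was alive at time
     [r - c]. *)
  rewrite (_ : _ `&` _ = [set w | alive tau r w v] `&` [set w | alive tau (r - c) w v]).
    by apply: measurableI => //; apply: hN; rewrite subr_ge0 cr gerBl ltW.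
  apply/seteqP; split=> w /= [aw]; rewrite ?in_itv/= ?andbT.
    rewrite /age le_max leNgt c0/= le_min cr/= lerBrDr -lerBrDl => h; split => //.
    rewrite /alive/= h/=; have /andP[_ h2] := aw; apply: lt_trans h2.
    by rewrite gtrBl.
  move=> /andP[h _]; split => //.
  by rewrite /age le_max le_min cr/= lerBrDr -lerBrDl h orbT.
pose alv w := `[< alive tau r w v >].
have mb : measurable_fun setT (alv : TF -> bool).
  apply: measurable_bool_set; move: mN.
  by congr measurable; apply/seteqP; split=> w /asboolP.
(* Age and position are known to the past only while [v] is alive; they are extended by 0. *)
have on_alive (f : T -> R) : measurable_fun ([set w | alive tau r w v] : set TF) f ->
    measurable_fun setT ((fun w => if alv w then f w else 0) : TF -> R).
  move=> mf; apply: measurable_fun_if => //.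
  rewrite setTI (_ : _ @^-1` _ = [set w | alive tau r w v])//.
  by apply/seteqP; split=> w /= /asboolP.
have -> : progeny_law psi v = fun w => if alv w
    then pair_law tau B r s t x y psi v
      (Num.max 0 (if alv w then age tau v r w else 0))
      (if alv w then position tau B v r w else 0) else (psi false false)%:R.
  by apply/funext => w; rewrite /progeny_law /alv; case: `[< _ >].
apply: measurable_fun_ifT => //.
exact: (measurableT_comp (@measurable_pair_law _ _ _ _ _ _ hBBM r s t x y psi v)
  (measurable_fun_pair (on_alive _ ma) (on_alive _ mp))).
Qed.

Local Open Scope ereal_scope.

Let diag_measurable v :
  measurable_fun setT ((fun w => (w, w)) : T ->
    sigmaT (clock_gen tau B (outside v)) * sigmaT (clock_gen tau B (inside v))).
Proof.
apply/measurable_fun_pairP; split.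
  exact: (@measurable_id_sub _ _ (clock_gen tau B (outside v))
    (@clock_gen_measurable _ _ _ _ tau B (outside v))).
exact: (@measurable_id_sub _ _ (clock_gen tau B (inside v))
  (@clock_gen_measurable _ _ _ _ tau B (inside v))).
Qed.

Let measurable_diag v (d' : measure_display) (U : measurableType d')
    (f : sigmaT (clock_gen tau B (outside v)) * sigmaT (clock_gen tau B (inside v)) -> U) :
  measurable_fun setT f -> measurable_fun setT ((fun w => f (w, w)) : T -> U).
Proof. by move=> mf; exact: (measurableT_comp mf (@diag_measurable v)). Qed.

(** Both sides are frozen: the left one with the event [psi], the right one with mere survival and
    the law as an additional weight. The resulting inner integrands agree by [pair_law_mul]. *)
Lemma integral_progeny_law v psi (g : T -> \bar R) :
  measurable_fun setT g -> (forall w, 0 <= g w) -> adapted tau B r v g ->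
  \int[P]_w (g w * (progeny_event psi v w)%:R%:E) =
  \int[P]_w (g w * (progeny_law psi v w)%:E).
Proof.
move=> mg g0 [g' [m1 m2 m3 m4]].
pose N := [set w | alive tau r w v].
have mN : measurable N by exact: measurable_alive.
have mE : measurable_fun setT (fun w => (progeny_event psi v w)%:R : R).
  exact: (measurable_clockT (@measurable_progeny_event setT v (fun _ _ => I) psi)).
have mL : measurable_fun setT (progeny_law psi v).
  exact: (measurable_clockT (@measurable_progeny_law setT v (fun _ _ => I) psi)).
have mgE : measurable_fun setT (fun w => g w * (progeny_event psi v w)%:R%:E).
  by apply: emeasurable_funM => //; exact/measurable_EFinP.
have mgL : measurable_fun setT (fun w => g w * (progeny_law psi v w)%:E).
  by apply: emeasurable_funM => //; exact/measurable_EFinP.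
have gE0 w : 0 <= g w * (progeny_event psi v w)%:R%:E by rewrite mule_ge0.
have gL0 w : 0 <= g w * (progeny_law psi v w)%:E.
  by rewrite mule_ge0// lee_fin progeny_law_ge0.
have NNC : [set: T] = N `|` ~` N by rewrite setUv.
have dNC : [disjoint N & ~` N] by apply/disj_set2P; rewrite setICr.
rewrite NNC !ge0_integral_setU//; do 1?[exact: measurableC]; do ?[exact: measurable_funTS].
(* Off [N] the event and the law both reduce to [psi false false]. *)
congr (_ + _); last first.
  apply: eq_integral => w; rewrite inE => nN; congr (_ * _%:E).
  rewrite /progeny_law asboolF// /progeny_event !asboolF//; by move=> [].
pose K phi := split_event tau B v r (pair_event tau B r s t x y phi v).
have mK phi : measurable_fun setT (fun w => (\1_(K phi) (w, w) : R)%:E).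
  apply/measurable_EFinP.
  have mKs := measurable_split_event hBBM r (@future_pair_event _ _ _ _ _ _ hBBM r s t x y phi
    v).1.
  exact: (@measurable_diag v _ _ _ (@measurable_indic _ _ R setT _ mKs)).
have aeN (f : T -> \bar R) h : measurable_fun setT f -> (forall w, 0 <= f w) ->
    measurable_fun setT h -> (forall w, 0 <= h w) ->
    (forall w, lifetimes_ge0 tau w -> N w -> f w = h w) ->
    (forall w, lifetimes_ge0 tau w -> ~ N w -> h w = 0) ->
    \int[P]_(w in N) f w = \int[P]_w h w.
  move=> mf f0 mh h0 e1 e2; rewrite integral_mkcond; apply: ge0_ae_eq_integral => //.
  - exact/(measurable_restrictT _ mN)/measurable_funTS.
  - by move=> w _; exact: erestrict_ge0.
  - apply: filterS (ae_lifetimes_ge0 hBBM) => w gw _; rewrite patchE.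
    case: ifPn; first by rewrite inE => Nw; exact: e1.
    by move=> /negP; rewrite inE => Nw; rewrite e2.
have mg' : measurable_fun setT (fun w : T => g' (w, w)).
  exact: (@measurable_diag v _ _ g' m1).
have KN phi w : lifetimes_ge0 tau w -> N w ->
    (w, w) \in K phi = phi `[< progeny_reaches v (s - r) x w >]
      `[< progeny_reaches v (t - r) y w >].
  move=> gw Nw; have spE := alive_position B Nw (lexx r).
  apply/idP/idP.
    rewrite inE => -[_ [_]]; rewrite /= -spE; congr (is_true (phi _ _));
    by apply/asboolP/asboolP => [h|[]//].
  move=> h; rewrite inE; split; first exact: alive_born.
  split; first exact: alive_age_lt.
  move: h; rewrite /= -spE; congr (is_true (phi _ _));
    by apply/asboolP/asboolP => [[]//|h].
have KnN phi w : ~ N w -> (w, w) \in K phi = false.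
  move=> nNw; apply/negbTE/negP; rewrite inE => -[/= bw [aw _]].
  by apply: nNw; exact: born_alive.
rewrite (aeN _ (fun w => g' (w, w) * (\1_(K psi) (w, w))%:E))//; last 4 first.
- exact: emeasurable_funM.
- by move=> w; rewrite mule_ge0// lee_fin.
- by move=> w gw Nw; rewrite m4// indicE KN.
- by move=> w gw Nw; rewrite indicE KnN// mule0.
(* The law in frozen coordinates: the age comes from the first copy, the position from both. *)
pose L p := pair_law tau B r s t x y psi v (Num.max 0%R (age tau v r p.1))
  (split_position tau B v r p).
have mLp : measurable_fun setT (L : sigmaT (clock_gen tau B (outside v)) *
    sigmaT (clock_gen tau B (inside v)) -> R).
  have ma := @measurable_comp_fst _ _ _ (sigmaT (clock_gen tau B (inside v))) _ _
    (@measurable_age _ _ _ _ tau B v r).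
  have mS := @measurable_split_position _ _ _ _ _ _ hBBM v r.
  exact: (measurableT_comp (@measurable_pair_law _ _ _ _ _ _ hBBM r s t x y psi v)
    (measurable_fun_pair ma mS)).
have L0 p : 0 <= (L p)%:E by rewrite lee_fin pair_law_ge0.
have mgL' : measurable_fun setT (fun p => g' p * (L p)%:E).
  by apply: emeasurable_funM => //; exact/measurable_EFinP.
rewrite (aeN _ (fun w => g' (w, w) * (L (w, w))%:E * (\1_(K (fun _ _ => true)) (w, w))%:E))//;
  last 4 first.
- apply: emeasurable_funM => //.
  exact: (@measurable_diag v _ _ _ mgL').
- by move=> w; rewrite mule_ge0// ?lee_fin// mule_ge0.
- move=> w gw Nw; rewrite m4// indicE KN// mule1 /progeny_law asboolT//.
  by rewrite /L (alive_position B Nw (lexx r)).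
- by move=> w gw Nw; rewrite indicE KnN// mule0.
rewrite (integral_freeze hBBM (future_pair_event hBBM r s t x y psi v) m1 m2 m3).
rewrite (integral_freeze hBBM (future_pair_event hBBM r s t x y (fun _ _ => true) v) mgL').
- apply: eq_integral => w0 _; congr (_ * _); apply: eq_integral => w1 _.
  rewrite -muleA; congr (_ * _).
  rewrite (pair_law_mul hBBM)//; last exact: age_ge0.
  by rewrite /L /= (max_idPr (age_ge0 _ _ _ _)).
- by move=> p; rewrite mule_ge0.
- move=> w0 bw; apply: emeasurable_funM; first exact: m3.
  apply/measurable_EFinP.
  have mS := @measurable_split_position_before _ _ _ _ tau B v r w0 r bw (lexx r).
  exact: (measurableT_comp (@measurable_pair_law _ _ _ _ _ _ hBBM r s t x y psi v)
    (measurable_fun_pair (measurable_cst (age tau v r w0)) mS)).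
Qed.

End ConditionalLaw.

(** * Conditional independence of several progenies *)

Section DisjointProgenies.
Context {d : measure_display} {T : measurableType d} {R : realType}.
Variable P : probability T R.
Variables (tau : particle -> {RV P >-> R}) (B : particle -> R -> {RV P >-> R}).
Hypothesis hBBM : is_BBM tau B.
Variables (r s t x y : R).
Hypothesis r0 : 0 <= r.

Local Notation event := (progeny_event tau B r s t x y).
Local Notation law := (progeny_law tau B r s t x y).

Lemma prefix_comparable (u v k : particle) :
  prefix u k -> prefix v k -> prefix u v || prefix v u.
Proof.
rewrite !prefixE => /eqP uk /eqP vk.
have [h|/ltnW h] := leqP (size u) (size v).
  by rewrite -vk take_takel// uk eqxx.
by rewrite -[in take (size v) u]uk take_takel// vk eqxx orbT.
Qed.

Lemma not_alive_comparable u v w : u != v -> prefix u v || prefix v u ->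
  lifetimes_ge0 tau w -> alive tau r w v -> ~ alive tau r w u.
Proof.
move=> uv /orP[] pre gw av au; move/eqP: uv; apply.
  exact: (@ralive_prefix_eq R (fun u => tau u w) gw r u v).
by apply/esym; exact: (@ralive_prefix_eq R (fun u => tau u w) gw r v u).
Qed.

Lemma event_not_alive psi v w : ~ alive tau r w v -> event psi v w = psi false false.
Proof. by move=> nv; rewrite /progeny_event !asboolF// => -[]. Qed.

Lemma law_not_alive psi v w : ~ alive tau r w v -> law psi v w = (psi false false)%:R.
Proof. by move=> nv; rewrite /progeny_law asboolF. Qed.

Lemma outside_incomparable u v : ~~ (prefix u v || prefix v u) ->
  forall k, prefix u (clock_label k) || prefix (clock_label k) u -> outside v k.
Proof.
move=> nuv k /orP[] h; apply/negP => vk; apply: (negP nuv).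
  exact: prefix_comparable vk.
by rewrite (prefix_trans vk h) orbT.
Qed.

Let adapted_const v (c : R) : 0 <= c -> adapted tau B r v (fun=> c%:E).
Proof. by move=> c0; apply: adapted_outside => // w; rewrite lee_fin. Qed.

(** If [u] and [v] are comparable and [v] is alive, then [u] is not, and the event is constant;
    otherwise the event of [u] reads only clocks outside the progeny of [v]. *)
Lemma adapted_event psi u v : u != v ->
  adapted tau B r v (fun w => (event psi u w)%:R%:E).
Proof.
move=> uv; have [cuv|nuv] := boolP (prefix u v || prefix v u).
  apply: (adapted_eq _ (@adapted_const v (psi false false)%:R _)) => // w gw aw.
  by rewrite event_not_alive//; exact: (not_alive_comparable uv).
apply: adapted_outside => // ; apply/measurable_EFinP.
exact: (@measurable_progeny_event _ _ _ _ _ _ hBBM r s t x y (outside v) u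
  (outside_incomparable nuv) psi).
Qed.

Lemma adapted_law psi u v : u != v -> adapted tau B r v (fun w => (law psi u w)%:E).
Proof.
move=> uv; have [cuv|nuv] := boolP (prefix u v || prefix v u).
  apply: (adapted_eq _ (@adapted_const v (psi false false)%:R _)) => // w gw aw.
  by rewrite law_not_alive//; exact: (not_alive_comparable uv).
apply: adapted_outside => [|w]; last by rewrite lee_fin progeny_law_ge0.
apply/measurable_EFinP.
exact: (@measurable_progeny_law _ _ _ _ _ _ hBBM r s t x y (outside v) u
  (outside_incomparable nuv) psi).
Qed.

Lemma measurable_event psi u : measurable_fun setT (fun w => (event psi u w)%:R : R).
Proof.
exact: (measurable_clockT (@measurable_progeny_event _ _ _ _ _ _ hBBM r s t x y setT u
  (fun _ _ => I) psi)).
Qed.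

Lemma measurable_law psi u : measurable_fun setT (law psi u).
Proof.
exact: (measurable_clockT (@measurable_progeny_law _ _ _ _ _ _ hBBM r s t x y setT u
  (fun _ _ => I) psi)).
Qed.

Lemma filtration_measurable C : filtration tau B r C -> measurable C.
Proof.
apply: g_sigma_measurable => _ [a [u [A [_ mA ->]]]].
apply: (g_sigma_measurable (@clock_gen_measurable _ _ _ _ tau B setT)).
have -> : [set w | alive tau a w u /\ A (position tau B u a w)] =
   [set w | alive tau a w u] `&` position tau B u a @^-1` A by [].
apply: (@measurableI _ (sigmaT (clock_gen tau B setT))).
  exact: (@measurable_alive_clock _ _ _ _ tau B a setT u (fun _ _ => I)).
exact: (sigmaT_measurable (@measurable_position_clock _ _ _ _ _ _ hBBM a setT u (fun _ _ => I))).
Qed.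

Section Past.
Variable C : set T.
Hypothesis FC : filtration tau B r C.

(** The event [C] of the past enters as a factor, so that it can be one of the adapted factors. *)
Definition mean_on (f : T -> R) : \bar R := (\int[P]_w (\1_C w * f w)%:E)%E.

Let mC : measurable C. Proof. exact: filtration_measurable. Qed.

Let mean_measurable (f : T -> R) : measurable_fun setT f ->
  measurable_fun setT (fun w => (\1_C w * f w)%:E).
Proof. by move=> mf; apply/measurable_EFinP/measurable_funM. Qed.

Lemma mean_on_ge0 (f : T -> R) : (forall w, 0 <= f w) -> (0 <= mean_on f)%E.
Proof. by move=> f0; apply: integral_ge0 => w _; rewrite lee_fin mulr_ge0. Qed.

Lemma mean_onD (f g : T -> R) : measurable_fun setT f -> measurable_fun setT g ->
  (forall w, 0 <= f w) -> (forall w, 0 <= g w) ->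
  (mean_on (fun w => f w + g w)%R = mean_on f + mean_on g)%E.
Proof.
move=> mf mg f0 g0; rewrite /mean_on -ge0_integralD//; try exact: mean_measurable;
  try by move=> w _; rewrite lee_fin mulr_ge0.
by apply: eq_integral => w _; rewrite mulrDr EFinD.
Qed.

Lemma mean_on_sum (V : seq particle) (f : particle -> T -> R) :
  (forall v, measurable_fun setT (f v)) -> (forall v w, 0 <= f v w) ->
  (mean_on (fun w => \sum_(v <- V) f v w)%R = \sum_(v <- V) mean_on (f v))%E.
Proof.
move=> mf f0; elim: V => [|v V IH].
  rewrite big_nil /mean_on integral0_eq// => w _; by rewrite big_nil mulr0.
rewrite big_cons -IH -mean_onD//; last 2 first.
- exact: measurable_sum.
- by move=> w; exact: sumr_ge0.
by apply: eq_integral => w _; rewrite big_cons.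
Qed.

Lemma le_mean_on (f g : T -> R) : measurable_fun setT f -> measurable_fun setT g ->
  (forall w, 0 <= f w <= g w) -> (mean_on f <= mean_on g)%E.
Proof.
move=> mf mg fg; apply: ge0_le_integral => //; try exact: mean_measurable.
- by move=> w _; have /andP[? _] := fg w; rewrite lee_fin mulr_ge0.
- by move=> w _; have /andP[? h] := fg w; rewrite lee_fin ler_wpM2l.
Qed.

Lemma mean_onE (f : T -> R) : mean_on f = (\int[P]_(w in C) (f w)%:E)%E.
Proof.
rewrite [RHS]integral_mkcond; apply: eq_integral => w _; rewrite patchE indicE.
by case: ifP => _; rewrite ?mul1r ?mul0r.
Qed.

Lemma mean_on_indic (D : set T) : measurable D -> mean_on \1_D = P (D `&` C).
Proof.
move=> mD; rewrite mean_onE integral_indic//.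
Qed.

(* The progenies of distinct particles alive at time [r] are conditionally
   independent given the past. *)
Lemma mean_on_prod (V : seq particle) (psi : particle -> bool -> bool -> bool) :
  uniq V ->
  mean_on (fun w => \prod_(v <- V) (event (psi v) v w)%:R) =
  mean_on (fun w => \prod_(v <- V) law (psi v) v w).
Proof.
move=> uV.
(* Factors are replaced one at a time: [V1] still carries events, [V2] already carries laws. *)
suff h (V1 V2 : seq particle) : uniq (V1 ++ V2) ->
    mean_on (fun w => \prod_(v <- V1) (event (psi v) v w)%:R * \prod_(v <- V2) law (psi v) v w) =
    mean_on (fun w => \prod_(v <- V1) law (psi v) v w * \prod_(v <- V2) law (psi v) v w).
  have := h V [::]; rewrite cats0 => /(_ uV).
  by rewrite /mean_on; under eq_integral do rewrite big_nil mulr1;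
    under [in RHS]eq_integral do rewrite big_nil mulr1.
elim: V1 V2 => [V2 _|v V1 IH V2 /=].
  by apply: eq_integral => w _; rewrite !big_nil.
move=> /andP[vV uV12].
pose f w := \prod_(v <- V1) (event (psi v) v w)%:R * \prod_(v <- V2) law (psi v) v w.
have mf : measurable_fun setT f.
  apply: measurable_funM; apply: measurable_prod => u _;
    [exact: measurable_event|exact: measurable_law].
have f0 w : 0 <= f w.
  by apply: mulr_ge0; apply: prodr_ge0 => u _ //; exact: progeny_law_ge0.
(* All factors other than that of [v] are adapted, since the labels of [V1] and [V2] differ from
   [v]. *)
have af : adapted tau B r v (fun w => (\1_C w * f w)%:E).
  apply: (@adapted_eq _ _ _ _ _ _ _ _ (fun w =>
    (\1_C w)%:E * ((\prod_(v <- V1) (event (psi v) v w)%:R)%:E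
    * (\prod_(v <- V2) law (psi v) v w)%:E))%E).
    by move=> w _ _; rewrite !EFinM.
  apply: adaptedM; first exact: adapted_filtration.
  apply: adaptedM; apply: adapted_prod => u uin.
    by apply: adapted_event; apply: contraNneq vV => <-; rewrite mem_cat uin.
  by apply: adapted_law; apply: contraNneq vV => <-; rewrite mem_cat uin orbT.
transitivity (mean_on (fun w => (event (psi v) v w)%:R * f w)).
  by apply: eq_integral => w _; congr (_ * _)%:E; rewrite big_cons /f mulrA.
transitivity (mean_on (fun w => law (psi v) v w * f w)).
  have h0 w : (0 <= (\1_C w * f w)%:E)%E by rewrite lee_fin mulr_ge0.
  have := integral_progeny_law hBBM s t x y (psi v) (mean_measurable mf) h0 af.
  rewrite /mean_on => e.
  transitivity (\int[P]_w ((\1_C w * f w)%:E * (event (psi v) v w)%:R%:E))%E.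
    by apply: eq_integral => w _; rewrite -EFinM; congr EFin; ring.
  rewrite e; apply: eq_integral => w _; rewrite -EFinM; congr EFin; ring.
have -> : mean_on (fun w => law (psi v) v w * f w) =
    mean_on (fun w => \prod_(v <- V1) (event (psi v) v w)%:R * \prod_(v <- v :: V2) law (psi v)
      v w).
  by apply: eq_integral => w _; congr (_ * _)%:E; rewrite big_cons /f mulrCA.
rewrite IH; last by rewrite -cat1s (perm_uniq (permEl (perm_catCA _ _ _)))/= vV.
by apply: eq_integral => w _; congr (_ * _)%:E; rewrite !big_cons mulrCA mulrA.
Qed.

End Past.
End DisjointProgenies.

(** * The inequality for finitely many labels *)

Lemma measurable_has_set {d : measure_display} {T : measurableType d}
    (V : seq particle) (f : particle -> T -> bool) :
  (forall v, measurable [set w | f v w]) -> measurable [set w | has (f ^~ w) V].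
Proof.
move=> mf; elim: V => [|v V' IH] /=; first by rewrite (_ : [set _ | _] = set0)//; apply/seteqP;
  split.
have -> : [set w | f v w || has (f ^~ w) V'] = [set w | f v w] `|` [set w | has (f ^~ w) V'].
  by apply/seteqP; split=> w /orP.
exact: measurableU.
Qed.

Section DisjointProgeniesInequality.
Context {d : measure_display} {T : measurableType d} {R : realType}.
Variable P : probability T R.
Variables (tau : particle -> {RV P >-> R}) (B : particle -> R -> {RV P >-> R}).
Hypothesis hBBM : is_BBM tau B.
Variables (r s t x y : R).
Hypothesis r0 : 0 <= r.

Local Notation event := (progeny_event tau B r s t x y).
Local Notation law := (progeny_law tau B r s t x y).

Lemma progeny_lawD psi phi v w : (forall i j, ~~ (psi i j && phi i j)) ->
  law (fun i j => psi i j || phi i j) v w = law psi v w + law phi v w.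
Proof.
move=> dis; rewrite /progeny_law; case: ifP => _.
  by rewrite (pair_lawD hBBM)// le_max lexx.
by have := dis false false; case: (psi _ _); case: (phi _ _) => //= _; rewrite ?addr0 ?add0r.
Qed.

Lemma progeny_law_true v w : law (fun _ _ => true) v w = 1.
Proof. by rewrite /progeny_law pair_law_true; case: ifP. Qed.

Definition miss_first (i j : bool) := ~~ i.
Definition miss_second (i j : bool) := ~~ j.
Definition miss_both (i j : bool) := ~~ i && ~~ j.

(** Written with the four atoms, the bounds and the inclusion-exclusion relation required by
    [prod_neither_le] are linear arithmetic. *)
Let law4 v w : exists p00 p01 p10 p11 : R,
  [/\ [/\ 0 <= p00, 0 <= p01, 0 <= p10 & 0 <= p11], p00 + p01 + p10 + p11 = 1,
      law miss_first v w = p00 + p01, law miss_second v w = p00 + p10 &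
      law miss_both v w = p00 /\ law andb v w = p11].
Proof.
exists (law miss_both v w), (law (fun i j => ~~ i && j) v w),
  (law (fun i j => i && ~~ j) v w), (law andb v w).
split => //.
- by split; exact: progeny_law_ge0.
- rewrite -!progeny_lawD; try by case; case.
  rewrite -[RHS](progeny_law_true v w); congr (law _ _ _).
  by apply/funext => -[]; apply/funext => -[].
- rewrite -progeny_lawD; last by case; case.
  by congr (law _ _ _); apply/funext => -[]; apply/funext => -[].
- rewrite -progeny_lawD; last by case; case.
  by congr (law _ _ _); apply/funext => -[]; apply/funext => -[].
Qed.

Lemma progeny_law_bounds v w :
  [/\ 0 <= law miss_first v w <= 1, 0 <= law miss_second v w <= 1,
      0 <= law miss_both v w & 0 <= law andb v w].
Proof.
have [p00 [p01 [p10 [p11 [[h1 h2 h3 h4] hs -> -> [-> ->]]]]]] := law4 v w.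
by split => //; lra.
Qed.

Lemma progeny_law_and v w :
  law andb v w = 1 - law miss_first v w - law miss_second v w + law miss_both v w.
Proof.
have [p00 [p01 [p10 [p11 [[h1 h2 h3 h4] hs -> -> [-> ->]]]]]] := law4 v w.
by lra.
Qed.

Definition hits_first v w : bool := `[< progeny_reaches tau B r v (s - r) x w >].
Definition hits_second v w : bool := `[< progeny_reaches tau B r v (t - r) y w >].

Section OnPast.
Variables (V : seq particle) (C : set T).
Hypotheses (uV : uniq V) (FC : filtration tau B r C).
Local Notation mean := (mean_on P C).

(** The conditional probability, given the past, that no label of [V] reaches [x] at time [s];
    [mean_hits_first] is the integrated statement. *)
Definition none_first w : R := \prod_(v <- V) law miss_first v w.
Definition none_second w : R := \prod_(v <- V) law miss_second v w.

Let measurable_prod_law psi (p : pred particle) :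
  measurable_fun setT (fun w => \prod_(v <- V | p v) law (psi v) v w).
Proof.
under eq_fun do rewrite big_mkcond/=.
apply: measurable_prod => u _; case: (p u) => //; exact: measurable_law.
Qed.

Let measurable_prod_event psi (p : pred particle) :
  measurable_fun setT (fun w => \prod_(v <- V | p v) (event (psi v) v w)%:R : R).
Proof.
under eq_fun do rewrite big_mkcond/=.
apply: measurable_prod => u _; case: (p u) => //; exact: measurable_event.
Qed.

Let prod_le1 (f : particle -> R) (V' : seq particle) :
  (forall v, 0 <= f v <= 1) -> \prod_(v <- V') f v <= 1.
Proof.
move=> f1; elim: V' => [|v V' IH]; first by rewrite big_nil.
have /andP[fv0 fv1] := f1 v.
rewrite big_cons mulr_ile1//; apply: prodr_ge0 => u _.
by have /andP[] := f1 u.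
Qed.

Lemma none_first_itv w : 0 <= none_first w <= 1.
Proof.
rewrite /none_first; apply/andP; split.
  by apply: prodr_ge0 => v _; exact: progeny_law_ge0.
by apply: prod_le1 => v; have [] := progeny_law_bounds v w.
Qed.

Lemma none_second_itv w : 0 <= none_second w <= 1.
Proof.
rewrite /none_second; apply/andP; split.
  by apply: prodr_ge0 => v _; exact: progeny_law_ge0.
by apply: prod_le1 => v; have [] := progeny_law_bounds v w.
Qed.

Lemma measurable_none_first : measurable_fun setT none_first.
Proof. exact: (measurable_prod_law (fun=> miss_first) xpredT). Qed.

Lemma measurable_none_second : measurable_fun setT none_second.
Proof. exact: (measurable_prod_law (fun=> miss_second) xpredT). Qed.

Lemma measurable_hits_first v : measurable [set w | hits_first v w].
Proof.
have := measurable_event hBBM r s t x y (fun i j => i) v.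
move=> /(_ measurableT [set 1] (measurable_set1 _)).
congr measurable; apply/seteqP; split=> w /=; rewrite /progeny_event -/(hits_first v w).
  by move=> [_]; case: hits_first => // /eqP; rewrite eq_sym oner_eq0.
by move=> ->.
Qed.

Lemma measurable_hits_second v : measurable [set w | hits_second v w].
Proof.
have := measurable_event hBBM r s t x y (fun i j => j) v.
move=> /(_ measurableT [set 1] (measurable_set1 _)).
congr measurable; apply/seteqP; split=> w /=; rewrite /progeny_event -/(hits_second v w).
  by move=> [_]; case: hits_second => // /eqP; rewrite eq_sym oner_eq0.
by move=> ->.
Qed.

Definition disjoint_hits : set T :=
  [set w | disj_occur V (hits_first ^~ w) (hits_second ^~ w)].

Lemma measurable_disjoint_hits : measurable disjoint_hits.
Proof.
apply: (@measurable_has_set _ _ V (fun v w => hits_first v w &&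
  has (fun u => (u != v) && hits_second u w) V)) => v.
rewrite (_ : [set _ | _] = [set w | hits_first v w] `&`
  [set w | has (fun u => (u != v) && hits_second u w) V]); last first.
  by apply/seteqP; split=> w /andP.
apply: measurableI; first exact: measurable_hits_first.
apply: (@measurable_has_set _ _ V (fun u w => (u != v) && hits_second u w)) => u.
case: (u != v); first exact: measurable_hits_second.
by rewrite (_ : [set _ | _] = set0)//; apply/seteqP; split.
Qed.

Let swap_prod (S : comRingType) (f g : particle -> S) v : v \in V ->
  \prod_(u <- V) (if u == v then f u else g u) = f v * \prod_(u <- V | u != v) g u.
Proof.
move=> vV; rewrite (bigD1_seq v)//= eqxx; congr (_ * _).
by apply: eq_bigr => u /negbTE ->.
Qed.

(** The pointwise relation [disj_occur_le] is integrated over [C], products of events are replaced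
    by products of laws through [mean_on_prod], and [prod_neither_le] is applied to the laws at each
    sample point. *)
Lemma mean_disjoint_hits :
  (P (disjoint_hits `&` C) <= mean (fun w => (1 - none_first w) * (1 - none_second w))%R)%E.
Proof.
have mC := filtration_measurable hBBM FC.
rewrite -(mean_on_indic hBBM FC measurable_disjoint_hits).
pose evp psi w : R := \prod_(v <- V) (event psi v w)%:R.
pose lwp psi w : R := \prod_(v <- V) law psi v w.
pose Se w : R := \sum_(v <- V) ((event andb v w)%:R * \prod_(u <- V | u != v)
  (event miss_both u w)%:R).
pose Sl w : R := \sum_(v <- V) (law andb v w * \prod_(u <- V | u != v) law miss_both u w).
have eSe : mean Se = mean Sl.
  rewrite /Se /Sl !(mean_on_sum hBBM FC)//; last 4 first.
  - by move=> v; apply: measurable_funM; [exact: (measurable_law hBBM r s t x y andb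
    v)|exact: (measurable_prod_law (fun=> miss_both))].
  - by move=> v w; rewrite mulr_ge0 ?progeny_law_ge0// prodr_ge0// => u _; exact: progeny_law_ge0.
  - by move=> v; apply: measurable_funM; [exact: (measurable_event hBBM r s t x y andb
    v)|exact: (measurable_prod_event (fun=> miss_both))].
  - by move=> v w; rewrite mulr_ge0// prodr_ge0.
  rewrite big_seq [RHS]big_seq; apply: eq_bigr => v vV.
  (* A term of the sum is again a product over [V]: joint hit at [v], joint miss at all other
     labels. *)
  have := mean_on_prod hBBM s t x y FC (fun u => if u == v then andb else miss_both) uV.
  congr (_ = _); apply: eq_integral => w _; congr (_ * _)%:E.
    rewrite -(swap_prod (fun u => (event andb u w)%:R : R) (fun u => (event miss_both u w)%:R))//.
    by apply: eq_bigr => u _; case: eqP.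
  rewrite -(swap_prod (fun u => law andb u w) (fun u => law miss_both u w))//.
  by apply: eq_bigr => u _; case: eqP.
have eprod psi : mean (evp psi) = mean (lwp psi).
  exact: (mean_on_prod hBBM s t x y FC (fun=> psi) uV).
have mevp psi : measurable_fun setT (evp psi) by exact: (measurable_prod_event (fun=> psi)
  xpredT).
have mlwp psi : measurable_fun setT (lwp psi) by exact: (measurable_prod_law (fun=> psi) xpredT).
have evp0 psi w : 0 <= evp psi w by apply: prodr_ge0.
have lwp0 psi w : 0 <= lwp psi w by apply: prodr_ge0 => u _; exact: progeny_law_ge0.
have mSe : measurable_fun setT Se.
  apply: measurable_sum => v; apply: measurable_funM;
    first exact: (measurable_event hBBM r s t x y andb v).
  exact: (measurable_prod_event (fun=> miss_both)).
have mSl : measurable_fun setT Sl.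
  apply: measurable_sum => v; apply: measurable_funM;
    first exact: (measurable_law hBBM r s t x y andb v).
  exact: (measurable_prod_law (fun=> miss_both)).
have Se0 w : 0 <= Se w by apply: sumr_ge0 => v _; rewrite mulr_ge0// prodr_ge0.
have Sl0 w : 0 <= Sl w.
  apply: sumr_ge0 => v _; rewrite mulr_ge0 ?progeny_law_ge0// prodr_ge0// => u _.
  exact: progeny_law_ge0.
(* The terms to be subtracted are added on the opposite side, which keeps all integrands
   nonnegative. *)
pose Ke w := evp miss_first w + evp miss_second w + Se w.
pose Kl w := lwp miss_first w + lwp miss_second w + Sl w.
have eK : mean Ke = mean Kl.
  rewrite /Ke /Kl !(mean_onD hBBM FC)//; do ?[exact: measurable_funD|by move=> w;
    rewrite addr_ge0].
  by rewrite !eprod eSe.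
have Ke0 w : 0 <= Ke w by rewrite !addr_ge0.
have Kl0 w : 0 <= Kl w by rewrite !addr_ge0.
have mKe : measurable_fun setT Ke by do 2 apply: measurable_funD => //.
have mKl : measurable_fun setT Kl by do 2 apply: measurable_funD => //.
pose D : T -> R := \1_disjoint_hits.
have D0 w : 0 <= D w by rewrite /D indicE.
have mD : measurable_fun setT D by apply: measurable_indic; exact: measurable_disjoint_hits.
pose G w := (1 - none_first w) * (1 - none_second w).
have mG : measurable_fun setT G.
  by apply: measurable_funM; apply: measurable_funB => //;
    [exact: measurable_none_first|exact: measurable_none_second].
have G0 w : 0 <= G w.
  have /andP[_ h1] := none_first_itv w; have /andP[_ h2] := none_second_itv w.
  by rewrite mulr_ge0// subr_ge0.
have le1 w : D w + Ke w <= 1 + evp miss_both w.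
  have := @disj_occur_le R particle V (hits_first ^~ w) (hits_second ^~ w) uV.
  rewrite /Ke !addrA; congr (_ + _ + _ + _ <= _).
  rewrite /D indicE; congr (nat_of_bool _)%:R.
  by apply/idP/idP; rewrite inE.
(* In [G + Kl] the single products of misses cancel, leaving 1 plus the right side of
   [prod_neither_le]. *)
have le2 w : 1 + lwp miss_both w <= G w + Kl w.
  have := prod_neither_le uV (progeny_law_bounds ^~ w) (progeny_law_and ^~ w).
  rewrite /G /Kl /none_first /none_second /lwp /Sl => h.
  by rewrite -subr_ge0 in h; rewrite -subr_ge0; move: h; lra.
(* The constant 2 bounds [Ke] by [le1], as the product of joint misses is at most 1. Finiteness
   allows [mean Ke] to be cancelled at the end. *)
have fin : (mean Ke < +oo)%E.
  apply: (@le_lt_trans _ _ (mean (fun=> 2))).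
    apply: (le_mean_on hBBM FC) => // w; rewrite Ke0/=.
    have := le1 w; have : evp miss_both w <= 1.
      by apply: prod_le1 => v; case: (event _ _ _); rewrite ?lexx ?ler01.
    by have := D0 w; lra.
  rewrite mean_onE (integral_cst P mC 2%:E).
  by apply: lte_mul_pinfty => //; rewrite ?lee_fin// ltey_eq fin_num_measure.
have h : (mean D + mean Ke <= mean G + mean Ke)%E.
  rewrite [in leRHS]eK -!(mean_onD hBBM FC)//.
  apply: (@le_trans _ _ (mean (fun w => 1 + evp miss_both w))).
    apply: (le_mean_on hBBM FC); do ?[exact: measurable_funD].
    by move=> w; rewrite le1 addr_ge0.
  rewrite (mean_onD hBBM FC (f := fun=> 1) (g := evp miss_both))// eprod.
  rewrite -(mean_onD hBBM FC)//.
  apply: (le_mean_on hBBM FC); do ?[exact: measurable_funD].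
  by move=> w; rewrite le2 addr_ge0.
have Kfin : mean Ke \is a fin_num by rewrite ge0_fin_numE// mean_on_ge0.
by rewrite leeD2rE in h.
Qed.

(** No hit and some hit are complementary, and [mean_on_prod] gives the first of them; the finite
    mean of the product is added to both sides and then cancelled. *)
Let mean_has (hits : particle -> T -> bool) (psi : bool -> bool -> bool) :
  (forall v, measurable [set w | hits v w]) ->
  (forall v w, event psi v w = ~~ hits v w) ->
  (forall w, \prod_(v <- V) law psi v w <= 1) ->
  mean (fun w => 1 - \prod_(v <- V) law psi v w) = P ([set w | has (hits ^~ w) V] `&` C).
Proof.
move=> mh eh l1.
have mH : measurable [set w | has (hits ^~ w) V] by exact: measurable_has_set.
have mC := filtration_measurable hBBM FC.
pose lwp w : R := \prod_(v <- V) law psi v w.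
pose evp w : R := \prod_(v <- V) (event psi v w)%:R.
have mlwp : measurable_fun setT lwp by exact: (measurable_prod_law (fun=> psi) xpredT).
have mevp : measurable_fun setT evp by exact: (measurable_prod_event (fun=> psi) xpredT).
have lwp0 w : 0 <= lwp w by apply: prodr_ge0 => u _; exact: progeny_law_ge0.
have eprod : mean evp = mean lwp := mean_on_prod hBBM s t x y FC (fun=> psi) uV.
have e1 : (mean (fun w => 1 - lwp w)%R + mean lwp = mean (fun=> 1%R))%E.
  rewrite -(mean_onD hBBM FC)//; first by apply: eq_integral => w _; rewrite subrK.
  - exact: measurable_funB.
  - by move=> w; rewrite subr_ge0 l1.
have e2 : (P ([set w | has (hits ^~ w) V] `&` C) + mean lwp = mean (fun=> 1%R))%E.
  rewrite -(mean_on_indic hBBM FC mH) -eprod -(mean_onD hBBM FC)//; last by move=> w;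
    exact: prodr_ge0.
  apply: eq_integral => w _; congr (_ * _)%:E; rewrite /evp.
  under eq_bigr do rewrite eh; rewrite prod_bool indicE all_predC.
  rewrite (_ : (w \in _) = has (hits ^~ w) V); last by apply/idP/idP; rewrite inE.
  by case: has; rewrite ?addr0 ?add0r.
have fin : mean lwp \is a fin_num.
  rewrite ge0_fin_numE ?mean_on_ge0//; apply: (@le_lt_trans _ _ (mean (fun=> 1%R))).
    by apply: (le_mean_on hBBM FC) => // w; rewrite lwp0 l1.
  rewrite mean_onE (integral_cst P mC 1%:E).
  by apply: lte_mul_pinfty => //; rewrite ?lee_fin// ltey_eq fin_num_measure.
by rewrite -[LHS](addeK _ fin) e1 -e2 addeK.
Qed.

Lemma mean_hits_first :
  mean (fun w => 1 - none_first w) = P ([set w | has (hits_first ^~ w) V] `&` C).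
Proof.
apply: mean_has => // [|w]; first exact: measurable_hits_first.
by have /andP[] := none_first_itv w.
Qed.

Lemma mean_hits_second :
  mean (fun w => 1 - none_second w) = P ([set w | has (hits_second ^~ w) V] `&` C).
Proof.
apply: mean_has => // [|w]; first exact: measurable_hits_second.
by have /andP[] := none_second_itv w.
Qed.

End OnPast.
End DisjointProgeniesInequality.

(** * Continuity of positions in time *)

Section PathContinuity.
Context {R : realType}.

Lemma continuous_rposition (l : particle -> R) (b : particle -> R -> R) u :
  (forall u, {within [set a : R | 0 <= a], continuous (b u)}) ->
  continuous (rposition l b u).
Proof.
move=> cb a; pose F (i : 'I_(size u).+1) c := b (take i u) (rlived l (take i u) c).
have hF i : {for a, continuous (F i)}; last first.
  suff h r : {for a, continuous (fun c => \sum_(i <- r) F i c)} by exact: h.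
  elim: r => [|i r IH].
    rewrite (_ : (fun c => _) = cst 0); first exact: cst_continuous.
    by apply/funext => c; rewrite big_nil.
  rewrite (_ : (fun c => _) = (fun c => F i c + \sum_(i <- r) F i c)).
    exact: (@continuousD _ R^o _ _ _ _ (hF i) IH).
  by apply/funext => c; rewrite big_cons.
have ge0 c : 0 <= rlived l (take i u) c by rewrite le_max lexx.
have cl : {for a, continuous (rlived l (take i u))}.
  apply: continuous_max; first exact: cvg_cst.
  apply: continuous_min; last exact: cvg_cst.
  by apply: cvgB; [exact: cvg_id|exact: cvg_cst].
have /subspace_continuousP/(_ _ (ge0 a)) c := cb (take i u).
apply: (cvg_comp _ _ _ c) => A /= [e e0 eA].
have hb : \forall c \near a, ball (rlived l (take i u) a) e (rlived l (take i u) c).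
  exact: (cl _ (nbhsx_ballx (rlived l (take i u) a) _ e0)).
suff : \forall c \near a, A (rlived l (take i u) c) by [].
by apply: filterS hb => c' h; exact: (eA _ h (ge0 c')).
Qed.

(** A disagreement at [a < ratr g] would persist on an interval to the right of [a], which contains
    a rational below [ratr g]; the end point is itself rational. *)
Lemma agree_rat (f h : R -> R) (g : rat) : continuous f -> continuous h ->
  (forall q : rat, 0 <= (ratr q : R) <= ratr g -> f (ratr q) = h (ratr q)) ->
  forall a : R, 0 <= a <= ratr g -> f a = h a.
Proof.
move=> cf ch fh a /andP[a0]; rewrite le_eqVlt => /orP[/eqP ag|ag].
  by rewrite ag; apply: fh; rewrite -ag a0 ag lexx.
apply/eqP; apply/negPn/negP => fha.
have cd : {for a, continuous (fun c => f c - h c)} by apply: cvgB; [exact: cf|exact: ch].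
have := open_nbhs_nbhs (conj (@open_neq R 0) (_ : f a - h a != 0)).
rewrite subr_eq0 => /(_ fha) /cd [e /= e0 he].
have ae : a < Num.min (a + e) (ratr g) by rewrite lt_min ag ltrDl e0.
have [q] := rat_in_itvoo ae.
rewrite in_itv/= lt_min => /andP[aq /andP[qe qg]].
have := he (ratr q); rewrite /= ltr0_norm ?subr_lt0// opprB ltrBlDl => /(_ qe).
by rewrite fh ?subrr ?eqxx// (le_trans a0 (ltW aq)) ltW.
Qed.

End PathContinuity.

(** * Maximum, splitting time and ancestors at time [r] *)

Section TwoRightmostParticles.
Context {d : measure_display} {T : measurableType d} {R : realType}.
Variable P : probability T R.
Variables (tau : particle -> {RV P >-> R}) (B : particle -> R -> {RV P >-> R}).
Hypothesis hBBM : is_BBM tau B.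

Lemma measurable_position u s : measurable_fun setT (position tau B u s).
Proof.
exact: (measurable_clockT (@measurable_position_clock _ _ _ _ _ _ hBBM s setT u (fun _ _ => I))).
Qed.

(** The supremum need not be attained at every sample point, so the level [x] is approached from
    below by the levels [x - n.+1%:R^-1]. *)
Lemma measurable_max_position s (x : R) :
  measurable [set w | (x%:E <= max_position tau B s w)%E].
Proof.
have -> : [set w | (x%:E <= max_position tau B s w)%E] =
    \bigcap_n \bigcup_u ([set w | alive tau s w u] `&`
      [set w | x - n.+1%:R^-1 < position tau B u s w]).
  apply/seteqP; split=> w /= h.
    move=> n _; have : ((x - n.+1%:R^-1)%:E < max_position tau B s w)%E.
      by apply: lt_le_trans h; rewrite lte_fin gtrBl.
    by move=> /ereal_sup_gt[_ [u au <-]]; rewrite lte_fin => hu; exists u.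
  apply/lee_subgt0Pr => e e0.
  have [n ne] : exists n : nat, n.+1%:R^-1 < e.
    have := near_infty_natSinv_lt (PosNum e0).
    by move=> [N _ /(_ N (leqnn _)) /= hN]; exists N.
  have [u _ [au hu]] := h n I.
  apply: (@le_trans _ _ (position tau B u s w)%:E); last by apply: ereal_sup_ubound; exists u.
  by rewrite -EFinB lee_fin (le_trans _ (ltW hu))// lerB// ltW.
apply: bigcap_measurableType => n _.
apply: countable_bigcupT_measurable => [|u]; first exact: countableP.
apply: measurableI; first exact: measurable_alive.
by apply: measurable_set_ltr => //; exact: measurable_position.
Qed.

Lemma continuous_position u w : continuous (fun a => position tau B u a w).
Proof.
apply: (@continuous_rposition R (fun u => tau u w) (fun u a => B u a w)) => u'.
exact: (@continuous_B _ _ _ _ _ _ hBBM u' w).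
Qed.

Lemma splitting_time_leP (r s t : R) u v w : 0 <= r ->
  splitting_time tau B s t u v w <= r <->
  forall g : rat, r < ratr g <= Num.min s t ->
    ~ forall q : rat, 0 <= (ratr q : R) <= ratr g ->
        position tau B u (ratr q) w = position tau B v (ratr q) w.
Proof.
move=> r0; rewrite /splitting_time; set S := [set g | _].
have ubS : has_ubound S by exists (Num.min s t) => g [/andP[]].
split=> [h g /andP[rg gst] hg|h].
  have Sg : S (ratr g).
    split; first by rewrite (ltW (le_lt_trans r0 rg)).
    by move=> a; apply: (@agree_rat R (fun a => position tau B u a w)
      (fun a => position tau B v a w)) => //;
      exact: continuous_position.
  by have := lt_le_trans rg (le_trans (ub_le_sup ubS Sg) h); rewrite ltxx.
rewrite leNgt; apply/negP => rS.
(* The supremum of the empty set is 0, which does not exceed [r]. *)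
have S0 : S !=set0.
  by apply/set0P/eqP => S0; move: rS; rewrite S0 sup0 ltNge r0.
have [g [/andP[g0 gst] hg] rg] := sup_gt S0 rS.
have [q] := rat_in_itvoo rg; rewrite in_itv/= => /andP[rq qg].
apply: (h q); first by rewrite rq (le_trans (ltW qg)).
by move=> c /andP[c0 cq]; apply: hg; rewrite c0 (le_trans cq (ltW qg)).
Qed.

Lemma measurable_splitting_time (r s t : R) (us ut : T -> particle) : 0 <= r ->
  (forall u, measurable (us @^-1` [set u])) -> (forall u, measurable (ut @^-1` [set u])) ->
  measurable [set w | splitting_time tau B s t (us w) (ut w) w <= r].
Proof.
move=> r0 mus mut.
have -> : [set w | splitting_time tau B s t (us w) (ut w) w <= r] =
   \bigcup_u \bigcup_v (us @^-1` [set u] `&` ut @^-1` [set v] `&`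
     [set w | splitting_time tau B s t u v w <= r]).
  apply/seteqP; split=> w /= h; first by exists (us w) => //; exists (ut w).
  by have [u _ [v _ [[/= -> ->]]]] := h.
apply: countable_bigcupT_measurable => [|u]; first exact: countableP.
apply: countable_bigcupT_measurable => [|v]; first exact: countableP.
apply: measurableI; first exact: measurableI.
pose E (g : rat) := \bigcup_(q in [set q : rat | 0 <= (ratr q : R) <= ratr g])
  [set w | position tau B u (ratr q) w != position tau B v (ratr q) w].
have mE g : measurable (E g).
  rewrite /E bigcup_mkcond; apply: bigcupT_measurable_rat => q.
  case: ifP => // _; rewrite (_ : [set _ | _] =
    ~` [set w | position tau B u (ratr q) w = position tau B v (ratr q) w]); last first.
    by apply/seteqP; split=> w /eqP.
  apply: measurableC.
  rewrite (_ : [set _ | _] = [set w | position tau B u (ratr q) w == position tau B v (ratr q)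
    w]); last first.
    by apply/seteqP; split=> w /eqP.
  by apply: measurable_set_bool; apply: measurable_fun_eqr; exact: measurable_position.
have -> : [set w | splitting_time tau B s t u v w <= r] =
    ~` \bigcup_(g in [set g : rat | r < ratr g <= Num.min s t]) ~` E g.
  apply/seteqP; split=> w.
    move=> /splitting_time_leP-/(_ r0) h [g hg nE]; apply: (h g hg) => q hq.
    by apply/eqP/negPn/negP => hne; apply: nE; exists q.
  move=> h; apply/splitting_time_leP => // g hg hall; apply: h; exists g => //.
  by move=> [q hq /=]; rewrite hall ?eqxx.
apply: measurableC; rewrite bigcup_mkcond; apply: bigcupT_measurable_rat => g.
by case: ifP => // _; exact: measurableC.
Qed.

Section Realization.
Variables (w : T) (r s t x y : R).
Hypotheses (gw : lifetimes_ge0 tau w) (r0 : 0 <= r).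

(** Time and level are generic: [hits_second] is convertible to [hits_first] at [t] and [y], and the
    lemmas of this section are applied to both. *)
Lemma hits_firstP v : r <= s -> alive tau r w v ->
  (hits_first tau B r s x v w <->
   exists q, alive tau s w (v ++ q) /\ x <= position tau B (v ++ q) s w).
Proof.
move=> rs av.
have := @reaches_shift R (fun u => tau u w) (fun u a => B u a w) v r s gw rs av x.
rewrite -/(birth tau v w) -(alive_age gw av) => h.
split; first by move=> /asboolP[_ /h].
by move=> /h hh; apply/asboolP; split.
Qed.

Lemma alive_hits u : r <= s -> alive tau s w u -> x <= position tau B u s w ->
  exists k, [/\ (k <= size u)%N, alive tau r w (take k u) &
    hits_first tau B r s x (take k u) w].
Proof.
move=> rs au hu.
have [k [ku ak]] := @ralive_ancestor R (fun u => tau u w) r s u r0 rs au.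
exists k; split => //; apply/(hits_firstP rs ak).
by exists (drop k u); rewrite cat_take_drop.
Qed.

Lemma hits_max_position v : r <= s -> hits_first tau B r s x v w ->
  (x%:E <= max_position tau B s w)%E.
Proof.
move=> rs h; have av : alive tau r w v by move/asboolP : h => [].
have [q [au hu]] := (hits_firstP rs av).1 h.
apply: (@le_trans _ _ (position tau B (v ++ q) s w)%:E); first by rewrite lee_fin.
by apply: ereal_sup_ubound; exists (v ++ q).
Qed.

Lemma rightmost_max_position u : is_rightmost tau B s w u ->
  (x%:E <= max_position tau B s w)%E -> x <= position tau B u s w.
Proof.
move=> [au hu] h; rewrite -lee_fin; apply: (le_trans h).
by apply: ub_ereal_sup => _ [v av <-]; rewrite lee_fin; exact: hu.
Qed.

(** The two paths coincide up to the smaller of [s] and the death of [v], and both of these exceed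
    [r]. *)
Lemma splitting_time_same_ancestor v p q : r < s -> s <= t ->
  alive tau r w v -> r < splitting_time tau B s t (v ++ p) (v ++ q) w.
Proof.
move=> rs st av; have /andP[_ hd] := av.
pose g := Num.min s (death tau v w).
apply: (@lt_le_trans _ _ g); first by rewrite lt_min rs.
apply: ub_le_sup; first by exists (Num.min s t) => c [/andP[]].
split.
  rewrite le_min (le_trans r0 (ltW rs)) (le_trans r0 (ltW hd))/=.
  by rewrite le_min ge_min lexx/= ge_min st.
move=> a /andP[a0 ag].
have early z : position tau B (v ++ z) a w = position tau B v a w.
  apply: (@rposition_cat_early R (fun u => tau u w) (fun u a => B u a w)) => //.
    by move=> u; exact: (B0 hBBM).
  by apply: (le_trans ag); rewrite ge_min lexx orbT.
by rewrite !early.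
Qed.

End Realization.
End TwoRightmostParticles.

(** * Bounds on versions of conditional probabilities *)

Section ConditionalProbabilityBounds.
Context {d : measure_display} {T : measurableType d} {R : realType}.
Variable P : probability T R.
Local Open Scope ereal_scope.

Lemma le_measure_ae (A A' : set T) : measurable A -> measurable A' ->
  {ae P, forall w, A w -> A' w} -> P A <= P A'.
Proof.
move=> mA mA' [N [mN N0 hN]].
apply: (@le_trans _ _ (P (A' `|` N))).
  apply: le_measure; rewrite ?inE//; first exact: measurableU.
  move=> w Aw; have [A'w|nA'w] := pselect (A' w); [by left|right].
  by apply: hN => /= h; exact/nA'w/h.
apply: (le_trans (measureU2 _ mA' mN)).
by rewrite -[leRHS]adde0; apply: leeD => //; rewrite -N0.
Qed.

Lemma integrable01 (f : T -> R) : measurable_fun setT f ->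
  (forall w, 0 <= f w <= 1)%R -> P.-integrable setT (EFin \o f).
Proof.
move=> mf f01; apply: (@le_integrable _ _ _ P setT measurableT _ (cst 1)).
- exact/measurable_EFinP.
- move=> w _ /=; have /andP[h1 h2] := f01 w.
  by rewrite normr1 lee_fin ger0_norm.
- exact: finite_measure_integrable_cst.
Qed.

Variable F0 : set (set T).
Hypothesis mF0 : F0 `<=` measurable.
Local Notation F := <<s F0 >>.

Lemma measurable_of_sub (f : T -> R) :
  measurable_fun setT (f : sigmaT F0 -> R) -> measurable_fun setT f.
Proof.
move=> mf _ Y mY; rewrite setTI.
exact: (g_sigma_measurable mF0 (sigmaT_measurable mf mY)).
Qed.

(** An arbitrary version [p] is bounded below through an event [H] almost surely inside [A], for
    which an explicit [f] is at most the conditional probability. *)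
Lemma cond_prob_ge (A H : set T) (f p : T -> R) : is_cond_prob P F A p ->
  measurable A -> measurable H -> {ae P, forall w, H w -> A w} ->
  measurable_fun setT (f : sigmaT F0 -> R) -> (forall w, 0 <= f w <= 1)%R ->
  (forall C, F C -> \int[P]_(w in C) (f w)%:E <= P (H `&` C)) ->
  {ae P, forall w, (f w <= p w)%R}.
Proof.
move=> [Fp Ip hp] mA mH HA mf f01 hf.
apply: (@ae_le_sub_sigma _ _ _ P F0) => //.
- exact: measurable_sigmaT.
- by apply: integrable01 => //; exact: measurable_of_sub.
- move=> C FC; rewrite hp//; apply: (le_trans (hf _ FC)).
  have mC := g_sigma_measurable mF0 FC.
  apply: le_measure_ae; try exact: measurableI.
  by apply: filterS HA => w h [/h].
Qed.

Lemma cond_prob_ge0 (A : set T) (p : T -> R) : is_cond_prob P F A p ->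
  measurable A -> {ae P, forall w, (0 <= p w)%R}.
Proof.
move=> hp mA; apply: (@cond_prob_ge A set0 (fun=> 0%R) p hp) => //.
- by apply: aeW.
- by move=> w; rewrite lexx ler01.
- by move=> C FC; rewrite integral0.
Qed.

Lemma cond_prob_le1 (A : set T) (p : T -> R) : is_cond_prob P F A p ->
  measurable A -> {ae P, forall w, (p w <= 1)%R}.
Proof.
move=> [Fp Ip hp] mA; apply: (@ae_le_sub_sigma _ _ _ P F0) => //.
- exact: measurable_sigmaT.
- by apply: integrable01 => // w; rewrite ler01 lexx.
- move=> C FC; have mC := g_sigma_measurable mF0 FC.
  rewrite hp// (integral_cst P mC 1) mul1e.
  by apply: le_measure; rewrite ?inE//; first exact: measurableI.
Qed.

(* The versions [p1] and [p2] lie in [0, 1] only almost surely, so that [p1 * p2]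
   need not be integrable a priori: hence the modifications [q1] and [q2]. *)
Lemma cond_prob_le_mul (D A1 A2 : set T) (p p1 p2 : T -> R) :
  is_cond_prob P F D p -> is_cond_prob P F A1 p1 -> is_cond_prob P F A2 p2 ->
  measurable A1 -> measurable A2 ->
  (forall (q1 q2 : T -> R) C, F C ->
     measurable_fun setT q1 -> measurable_fun setT q2 ->
     (forall w, 0 <= q1 w <= 1)%R -> (forall w, 0 <= q2 w <= 1)%R ->
     {ae P, forall w, q1 w = p1 w} -> {ae P, forall w, q2 w = p2 w} ->
     P (D `&` C) <= \int[P]_(w in C) (q1 w * q2 w)%:E) ->
  {ae P, forall w, (p w <= p1 w * p2 w)%R}.
Proof.
move=> [Fp Ip hp] h1 h2 mA1 mA2 hD.
have [Fp1 _ _] := h1; have [Fp2 _ _] := h2.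
pose clip (q : T -> R) w : R := Num.max 0%R (Num.min 1%R (q w)).
have clip01 q w : (0 <= clip q w <= 1)%R.
  by rewrite /clip le_max lexx/= ge_max ler01 ge_min lexx.
have clipE q : {ae P, forall w, (0 <= q w)%R} -> {ae P, forall w, (q w <= 1)%R} ->
    {ae P, forall w, clip q w = q w}.
  by apply: filterS2 => w q0 q1; rewrite /clip (min_idPr q1) (max_idPr q0).
have e1 := clipE _ (cond_prob_ge0 h1 mA1) (cond_prob_le1 h1 mA1).
have e2 := clipE _ (cond_prob_ge0 h2 mA2) (cond_prob_le1 h2 mA2).
have mclip q : (forall Y, measurable Y -> F (q @^-1` Y)) ->
    measurable_fun setT (clip q : sigmaT F0 -> R).
  move=> /measurable_sigmaT mq; apply: measurable_maxr => //.
  exact: measurable_minr.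
have m1 := mclip _ Fp1; have m2 := mclip _ Fp2.
have : {ae P, forall w, (p w <= clip p1 w * clip p2 w)%R}.
  apply: (@ae_le_sub_sigma _ _ _ P F0) => //.
  - exact: measurable_sigmaT.
  - exact: measurable_funM.
  - apply: integrable01.
      by apply: measurable_funM; exact: measurable_of_sub.
    move=> w; have /andP[? ?] := clip01 p1 w; have /andP[? ?] := clip01 p2 w.
    by rewrite mulr_ge0//= mulr_ile1.
  - by move=> C FC; rewrite hp//; apply: hD => //; exact: measurable_of_sub.
by apply: (filterS3 _ _ e1 e2) => w -> ->.
Qed.

End ConditionalProbabilityBounds.

(** * The monotone limit and the conclusion *)

Section MainProof.
Context {d : measure_display} {T : measurableType d} {R : realType}.
Variable P : probability T R.
Variables (tau : particle -> {RV P >-> R}) (B : particle -> R -> {RV P >-> R}).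
Hypothesis hBBM : is_BBM tau B.
Variables (r s t x y : R).
Hypotheses (r0 : 0 <= r) (st : s <= t).
Variables (us ut : T -> particle).
Hypotheses (hus : rightmost_particle tau B s us) (hut : rightmost_particle tau B t ut).

Let A1 := [set w | (x%:E <= max_position tau B s w)%E].
Let A2 := [set w | (y%:E <= max_position tau B t w)%E].
Let D := [set w | [/\ (x%:E <= max_position tau B s w)%E,
  (y%:E <= max_position tau B t w)%E & splitting_time tau B s t (us w) (ut w) w <= r]].
Let F0 := filtration_gen tau B r.

Let mA1 : measurable A1. Proof. exact: measurable_max_position. Qed.
Let mA2 : measurable A2. Proof. exact: measurable_max_position. Qed.

Let mD : measurable D.
Proof.
have -> : D = A1 `&` A2 `&` [set w | splitting_time tau B s t (us w) (ut w) w <= r].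
  by apply/seteqP; split=> w [] // [].
apply: measurableI; first exact: measurableI.
by apply: measurable_splitting_time => //; [case: hus|case: hut].
Qed.

Let mF0 : F0 `<=` measurable.
Proof.
by move=> E EF; apply: (filtration_measurable hBBM (r := r)); exact: sub_sigma_algebra.
Qed.

(** Increasing finite lists exhausting the countable set of labels; [undup] supplies the uniqueness
    required for the product formulas. *)
Definition first_particles (n : nat) : seq particle := undup (pmap unpickle (iota 0 n)).

Lemma mem_first_particles n (u : particle) : (pickle u < n)%N -> u \in first_particles n.
Proof.
move=> un; rewrite mem_undup mem_pmap; apply/mapP; exists (pickle u).
  by rewrite mem_iota.
by rewrite pickleK.
Qed.

Lemma first_particles_sub n m (u : particle) : (n <= m)%N ->
  u \in first_particles n -> u \in first_particles m.
Proof.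
move=> nm; rewrite !mem_undup !mem_pmap => /mapP[k]; rewrite !mem_iota /= !add0n => kn ->.
by apply: map_f; rewrite mem_iota /= add0n (leq_trans kn).
Qed.

Local Notation none1 n := (none_first tau B r s t x y (first_particles n)).
Local Notation none2 n := (none_second tau B r s t x y (first_particles n)).
Local Notation disj n := (disjoint_hits tau B r s t x y (first_particles n)).

(** A hit by one of finitely many labels almost surely forces [A1], and [1 - none1 n] is the
    conditional probability of such a hit. *)
Lemma none_first_le n p1 : r <= s -> is_cond_prob P (filtration tau B r) A1 p1 ->
  {ae P, forall w, 1 - none1 n w <= p1 w}.
Proof.
move=> rs h1.
have mh v := measurable_hits_first hBBM r s t x y v.
apply: (@cond_prob_ge _ _ _ P F0 mF0 A1
  [set w | has (hits_first tau B r s x ^~ w) (first_particles n)] _ _ h1) => //.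
- exact: measurable_has_set.
- apply: filterS (ae_lifetimes_ge0 hBBM) => w gw /= /hasP[v _ hv].
  exact: (hits_max_position gw rs hv).
- apply: measurable_funB => //.
  by apply: measurable_prod => v _; exact: measurable_progeny_law_filtration.
- move=> w; have /andP[h0 h1'] := none_first_itv hBBM r s t x y (first_particles n) w.
  by rewrite subr_ge0 h1' gerBl.
- move=> C FC; rewrite -mean_onE.
  by rewrite (mean_hits_first hBBM s t x y (undup_uniq _) FC).
Qed.

Lemma none_second_le n p2 : r <= t -> is_cond_prob P (filtration tau B r) A2 p2 ->
  {ae P, forall w, 1 - none2 n w <= p2 w}.
Proof.
move=> rt h2.
have mh v := measurable_hits_second hBBM r s t x y v.
apply: (@cond_prob_ge _ _ _ P F0 mF0 A2
  [set w | has (hits_second tau B r t y ^~ w) (first_particles n)] _ _ h2) => //.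
- exact: measurable_has_set.
- apply: filterS (ae_lifetimes_ge0 hBBM) => w gw /= /hasP[v _ hv].
  exact: (hits_max_position gw rt hv).
- apply: measurable_funB => //.
  by apply: measurable_prod => v _; exact: measurable_progeny_law_filtration.
- move=> w; have /andP[h0 h1'] := none_second_itv hBBM r s t x y (first_particles n) w.
  by rewrite subr_ge0 h1' gerBl.
- move=> C FC; rewrite -mean_onE.
  by rewrite (mean_hits_second hBBM s t x y (undup_uniq _) FC).
Qed.

(* The ancestors at time [r] of the two rightmost particles differ. *)
Lemma disjoint_hits_cover : r < s -> {ae P, forall w, D w -> exists n, disj n w}.
Proof.
move=> rs; have [_ rs1] := hus; have [_ rt1] := hut.
have rt := lt_le_trans rs st.
apply: (filterS3 _ _ (ae_lifetimes_ge0 hBBM) rs1 rt1) => w gw ru rv [hx hy hQ].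
have [au _] := ru; have [av _] := rv.
have xu := rightmost_max_position ru hx; have yv := rightmost_max_position rv hy.
have [k [ku ak hk]] := alive_hits gw r0 (ltW rs) au xu.
have [j [jv aj hj]] := alive_hits gw r0 (ltW rt) av yv.
set p := take k (us w) in ak hk; set q := take j (ut w) in aj hj.
(* A common ancestor at time [r] would make the splitting time exceed [r]. *)
have pq : q != p.
  apply/negP => /eqP qp.
  have h : r < splitting_time tau B s t (p ++ drop k (us w)) (p ++ drop j (ut w)) w.
    exact: splitting_time_same_ancestor.
  rewrite -[X in splitting_time _ _ _ _ _ (X ++ _)]qp !cat_take_drop in h.
  by have := lt_le_trans h hQ; rewrite ltxx.
exists (maxn (pickle p) (pickle q)).+1.
apply/hasP; exists p; first by apply: mem_first_particles; rewrite ltnS leq_maxl.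
rewrite hk /=; apply/hasP; exists q; first by apply: mem_first_particles; rewrite ltnS leq_maxr.
by rewrite pq.
Qed.

(** [D] is almost surely covered by the increasing events [disj n]. For each [n] the integrand
    [(1 - none1 n) * (1 - none2 n)] is already at most [q1 * q2], so a limit is taken on the left
    side only. *)
Lemma cond_bound_lt (q1 q2 p1 p2 : T -> R) C : r < s -> filtration tau B r C ->
  is_cond_prob P (filtration tau B r) A1 p1 -> is_cond_prob P (filtration tau B r) A2 p2 ->
  measurable_fun setT q1 -> measurable_fun setT q2 ->
  (forall w, 0 <= q1 w <= 1) -> (forall w, 0 <= q2 w <= 1) ->
  {ae P, forall w, q1 w = p1 w} -> {ae P, forall w, q2 w = p2 w} ->
  (P (D `&` C) <= \int[P]_(w in C) (q1 w * q2 w)%:E)%E.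
Proof.
move=> rs FC h1 h2 mq1 mq2 b1 b2 e1 e2.
have rt := lt_le_trans rs st; have mC := filtration_measurable hBBM FC.
have mdisj n := measurable_disjoint_hits hBBM r s t x y (first_particles n).
have mU : measurable (\bigcup_n (disj n `&` C)).
  by apply: bigcupT_measurable => n; exact: measurableI.
apply: (@le_trans _ _ (P (\bigcup_n (disj n `&` C)))).
  apply: le_measure_ae => //; first exact: measurableI.
  by apply: filterS (disjoint_hits_cover rs) => w h [/h[n hn] Cw]; exists n.
have ndF : {homo (fun n => disj n `&` C) : n m / (n <= m)%N >-> (n <= m)%O}.
  move=> n m nm; apply/subsetPset => w [/hasP[v vV /andP[hv /hasP[u uV hu]]] Cw].
  split => //; apply/hasP; exists v; first exact: first_particles_sub vV.
  by rewrite hv; apply/hasP; exists u => //; exact: first_particles_sub uV.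
have cF := nondecreasing_cvg_mu (mu := P) (fun n => measurableI _ _ (mdisj n) mC) mU ndF.
rewrite -(cvg_lim _ cF)//; apply: lime_le; first by apply/cvg_ex; eexists; exact: cF.
apply: nearW => n /=.
apply: (le_trans (mean_disjoint_hits hBBM s t x y (undup_uniq _) FC)).
have i1 w := none_first_itv hBBM r s t x y (first_particles n) w.
have i2 w := none_second_itv hBBM r s t x y (first_particles n) w.
have m1 := measurable_none_first hBBM r s t x y (first_particles n).
have m2 := measurable_none_second hBBM r s t x y (first_particles n).
rewrite mean_onE; apply: ae_ge0_le_integral => //.
- move=> w _; have /andP[_ h3] := i1 w; have /andP[_ h4] := i2 w.
  by rewrite lee_fin mulr_ge0// subr_ge0.
- apply/measurable_EFinP/measurable_funTS/measurable_funM; exact: measurable_funB.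
- move=> w _; have /andP[h3 _] := b1 w; have /andP[h4 _] := b2 w.
  by rewrite lee_fin mulr_ge0.
- exact/measurable_EFinP/measurable_funTS/measurable_funM.
have l1 := none_first_le n (ltW rs) h1; have l2 := none_second_le n (ltW rt) h2.
have l1' : {ae P, forall w, 1 - none1 n w <= q1 w} by apply: (filterS2 _ _ l1 e1) => w + ->.
have l2' : {ae P, forall w, 1 - none2 n w <= q2 w} by apply: (filterS2 _ _ l2 e2) => w + ->.
apply: (filterS2 _ _ l1' l2') => w h3 h4 _; rewrite lee_fin.
have /andP[_ h5] := i1 w; have /andP[_ h6] := i2 w.
by apply: ler_pM; rewrite ?subr_ge0.
Qed.

(* At [s = r] the event [M_s >= x] already belongs to the past. *)
Lemma cond_bound_eq (q1 q2 p1 p2 : T -> R) C : r = s -> filtration tau B r C ->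
  is_cond_prob P (filtration tau B r) A1 p1 -> is_cond_prob P (filtration tau B r) A2 p2 ->
  measurable_fun setT q1 -> measurable_fun setT q2 ->
  (forall w, 0 <= q1 w <= 1) -> (forall w, 0 <= q2 w <= 1) ->
  {ae P, forall w, q1 w = p1 w} -> {ae P, forall w, q2 w = p2 w} ->
  (P (D `&` C) <= \int[P]_(w in C) (q1 w * q2 w)%:E)%E.
Proof.
move=> rs FC h1 h2 mq1 mq2 b1 b2 e1 e2.
(* The event [A1] written with generators of the past; the two differ only where the supremum is not
   attained. *)
pose A' := \bigcup_u [set w | alive tau r w u /\ [set z | x <= z] (position tau B u r w)].
have FA' : filtration tau B r A'.
  apply: (@countable_bigcupT_measurable _ (sigmaT F0)) => [|u]; first exact: countableP.
  apply: sub_sigma_algebra; exists r, u, [set z | x <= z]; split => //.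
    by rewrite r0 lexx.
  by rewrite (_ : [set z | x <= z] = `[x, +oo[%classic)//; apply/seteqP; split=> z /=;
    rewrite in_itv/= andbT.
have mA' : measurable A' by exact: (filtration_measurable hBBM FA').
have mC := filtration_measurable hBBM FC.
have A1A' : {ae P, forall w, A1 w -> A' w}.
  have [_ rs1] := hus; apply: filterS rs1 => w ru hx; exists (us w) => //.
  have := rightmost_max_position ru hx; have [au _] := ru.
  by rewrite rs => hxu; split.
have A'A1 w : A' w -> A1 w.
  move=> [u _ [au hu]]; rewrite /A1 -rs /=.
  apply: (@le_trans _ _ (position tau B u r w)%:E); first by rewrite lee_fin.
  by apply: ereal_sup_ubound; exists u.
have FCA' : filtration tau B r (C `&` A').
  exact: (@measurableI _ (sigmaT F0)).
have q1A' : {ae P, forall w, (\1_A' w : R) <= p1 w}.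
  apply: (@cond_prob_ge _ _ _ P F0 mF0 A1 A' _ _ h1) => //.
  - by apply: aeW => w; exact: A'A1.
  - by move=> w; rewrite indicE; case: (_ \in _); rewrite ?lexx ?ler01.
  - by move=> E FE; have mE := filtration_measurable hBBM FE; rewrite integral_indic.
have [_ _ hp2] := h2.
(* This probability is the integral over [C] of [p2] times the indicator of [A'], and that indicator
   is almost surely at most [p1]. *)
apply: (@le_trans _ _ (P (A2 `&` (C `&` A')))).
  apply: le_measure_ae; try by do ?apply: measurableI.
  by apply: filterS A1A' => w h [[/h A'w hy _] Cw].
rewrite -hp2//.
have -> : (\int[P]_(w in C `&` A') (p2 w)%:E = \int[P]_(w in C `&` A') (q2 w)%:E)%E.
  have [Fp2 Ip2 _] := h2.
  apply: ae_eq_integral; [exact: measurableI| | |].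
  - by apply: measurable_funTS; apply/measurable_EFinP; apply: (measurable_of_sub mF0);
    exact: measurable_sigmaT.
  - by apply: measurable_funTS; apply/measurable_EFinP.
  - by apply: filterS e2 => w -> _.
have -> : (\int[P]_(w in C `&` A') (q2 w)%:E = \int[P]_(w in C) (\1_A' w * q2 w)%:E)%E.
  rewrite setIC integral_mkcondl; apply: eq_integral => w _.
  by rewrite patchE indicE; case: ifP => _; rewrite ?mul1r ?mul0r.
apply: ae_ge0_le_integral => //.
- by move=> w _; have /andP[h3 _] := b2 w; rewrite lee_fin mulr_ge0.
- by apply/measurable_EFinP/measurable_funTS/measurable_funM.
- move=> w _; have /andP[h3 _] := b1 w; have /andP[h4 _] := b2 w.
  by rewrite lee_fin mulr_ge0.
- exact/measurable_EFinP/measurable_funTS/measurable_funM.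
apply: (filterS2 _ _ q1A' e1) => w h3 e _; rewrite lee_fin ler_wpM2r//.
  by have /andP[] := b2 w.
by rewrite e.
Qed.

(** The case [s = r] is separate because the splitting time never exceeds [s]: the condition on it
    then says nothing about the ancestors at time [r]. *)
Lemma cond_prob_disjoint_le (p p1 p2 : T -> R) : r <= s ->
  is_cond_prob P (filtration tau B r) D p ->
  is_cond_prob P (filtration tau B r) A1 p1 -> is_cond_prob P (filtration tau B r) A2 p2 ->
  {ae P, forall w, p w <= p1 w * p2 w}.
Proof.
move=> rs h h1 h2.
apply: (@cond_prob_le_mul _ _ _ P F0 mF0 D A1 A2) => // q1 q2 C FC m1 m2 b1 b2 e1 e2.
move: rs; rewrite le_eqVlt => /orP[/eqP rs|rs].
  exact: (cond_bound_eq rs FC h1 h2).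
exact: (cond_bound_lt rs FC h1 h2).
Qed.

End MainProof.

Theorem proposition2p5 (R : realType) (d : measure_display)
    (T : measurableType d) (P : probability T R)
    (tau : particle -> {RV P >-> R}) (B : particle -> R -> {RV P >-> R})
    (hBBM : is_BBM tau B)
    (r s t x y : R) (hr : 0 <= r) (hrs : r <= s) (hst : s <= t)
    (us ut : T -> particle)
    (hus : rightmost_particle tau B s us)
    (hut : rightmost_particle tau B t ut)
    (pst ps pt : T -> R)
    (hpst : is_cond_prob P (filtration tau B r)
       [set w | [/\ (x%:E <= max_position tau B s w)%E,
                    (y%:E <= max_position tau B t w)%E &
                    splitting_time tau B s t (us w) (ut w) w <= r]] pst)
    (hps : is_cond_prob P (filtration tau B r)
       [set w | (x%:E <= max_position tau B s w)%E] ps)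
    (hpt : is_cond_prob P (filtration tau B r)
       [set w | (y%:E <= max_position tau B t w)%E] pt) :
  {ae P, forall w, pst w <= ps w * pt w}.
Proof.
exact: (cond_prob_disjoint_le hBBM hr hst hus hut hrs hpst hps hpt).
Qed.
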